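(* Let $(X,d,\mu)$ be a complete metric space with a Borel regular outer measure $\mu$ that is doubling with constant $c_D>1$ in the sense given in the context. Let $N\ge 2$ be an integer. There exist constants $c_1>0$ and $c_2>0$, depending only on $c_D$ and $N$, such that the following holds for every $\lambda>1$ and all $\mu$-measurable subsets $E_1,\dots,E_N$ of $X$. (a) Suppose that $$\min_{1\le j\le N}\frac{\mu(E_j\cap B)}{\mu(B)}\le c_D^{-4\lambda}\quad\text{for every ball } B\subset X. \qquad ( * )$$ Then there exist functions $f_1,\dots,f_N\colon X\to\mathbb{R}$ such that $$\sum_{j=1}^N f_j(x)=1,$$ and, for each $1\le j\le N$, $$0\le f_j(x)\le 1,\qquad f_j(x)=0 \ \text{ for } \mu\text{-almost every } x\in E_j,\qquad \|f_j\|_*\le \frac{c_1}{\lambda}.$$ (b) Conversely, suppose there exist functions $f_1,\dots,f_N\colon X\to\mathbb{R}$ such that $\sum_{j=1}^N f_j(x)=1$ and, for each $1\le j\le N$, $0\le f_j(x)\le 1$, $f_j(x)=0$ for $\mu$-almost every $x\in E_j$, and $\|f_j\|_*\le c_2/\lambda$. Then $( * )$ holds.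
   Context: $(X,d)$ is a complete metric space and $\mu$ is a Borel regular outer measure on $X$ with $0<\mu(B)<\infty$ for every ball $B$. Balls are open: $B=B(x,r)=\{y\in X: d(y,x)<r\}$, $x\in X$, $r>0$. The measure $\mu$ is doubling with constant $c_D>1$ in the following sense: for all $x,y\in X$ and $0<r<\infty$ with $B(x,2r)\cap B(y,r)\ne\emptyset$ one has $\mu(B(x,2r))\le c_D\,\mu(B(y,r))$. For a locally integrable function $f\colon X\to\mathbb{R}$ and a ball $B$, $f_B=\frac{1}{\mu(B)}\int_B f\,d\mu$, and $$\|f\|_*=\sup_{B}\frac{1}{\mu(B)}\int_B|f-f_B|\,d\mu,$$ the supremum being over all balls $B\subset X$. *)

(* Defs.v *)
From HB Require Import structures.
From mathcomp Require Import all_boot all_order all_algebra.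
From mathcomp Require Import all_classical all_reals all_analysis.

Set Implicit Arguments.
Unset Strict Implicit.
Unset Printing Implicit Defensive.
Import Order.TTheory GRing.Theory Num.Theory.
Import numFieldNormedType.Exports.

Local Open Scope classical_set_scope.
Local Open Scope ring_scope.

(* The class [Complete] contains [Pointed] (as does [measurableType]), so
   these spaces are nonempty. By [ballEmdist], [ball x r] is the open ball
   [set y | mdist x y < r]. *)
#[short(type="completeMetricType")]
HB.structure Definition CompleteMetric (K : numDomainType) :=
  {X of Complete X & Metric K X}.

Section outer_measure_on_metric_space.
Context {R : realType} {X : completeMetricType R}.
Variable mu : {outer_measure set X -> \bar R}.
Local Open Scope ereal_scope.

Definition borel (A : set X) : Prop := <<s [set U : set X | open U] >> A.

Definition borel_regular : Prop :=
  borel `<=` mu.-caratheodory /\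
  forall A : set X, exists B : set X, [/\ borel B, A `<=` B & mu B = mu A].

Definition positive_finite_on_balls : Prop :=
  forall (x : X) (r : R), (0 < r)%R -> 0 < mu (ball x r) < +oo.

(* The two balls only need to meet: this contains the usual doubling
   condition (take [y = x]). *)
Definition doubling (cD : R) : Prop :=
  forall (x y : X) (r : R), (0 < r)%R ->
    ball x (2 * r)%R `&` ball y r !=set0 ->
    mu (ball x (2 * r)%R) <= cD%:E * mu (ball y r).

(* The restriction of [mu] to its Caratheodory-measurable sets, as a measure;
   mu-measurability, integrals and "mu-almost everywhere" refer to it. *)
Definition cara_measure : {measure set (caratheodory_type mu) -> \bar R} :=
  (mu : set (caratheodory_type mu) -> \bar R).

(* In a complete doubling space closed balls are compact, so integrability on
   all balls is the same as integrability near every point, or on compacta. *)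
Definition loc_integrable (f : X -> R) : Prop :=
  measurable_fun [set: caratheodory_type mu] f /\
  forall (x : X) (r : R), (0 < r)%R ->
    cara_measure.-integrable (ball x r) (EFin \o f).

Definition ball_mean (f : X -> R) (x : X) (r : R) : R :=
  ((fine (mu (ball x r)))^-1 * \int[cara_measure]_(y in ball x r) f y)%R.

Definition mean_oscillation (f : X -> R) (x : X) (r : R) :
    \bar R :=
  (mu (ball x r))^-1 *
  \int[cara_measure]_(y in ball x r) `|f y - ball_mean f x r|%:E.

Definition bmo_norm (f : X -> R) : \bar R :=
  ereal_sup [set t | exists (x : X) (r : R),
                       (0 < r)%R /\ t = mean_oscillation f x r].

(* Minima are over a nonempty index set as soon as [0 < N]; [+oo] is the
   neutral element of [Order.min]. *)
Definition min_density_le (N : nat) (E : 'I_N -> set X) (a : R) : Prop :=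
  forall (x : X) (r : R), (0 < r)%R ->
    \big[Order.min/+oo]_(j < N) (mu (E j `&` ball x r) / mu (ball x r))
      <= a%:E.

(* [loc_integrable] is what makes [bmo_norm (f j)] meaningful. *)
Definition bmo_partition (N : nat) (E : 'I_N -> set X) (c : R)
    (f : 'I_N -> X -> R) : Prop :=
  (forall x, (\sum_(j < N) f j x = 1)%R) /\
  forall j, [/\ forall x, (0 <= f j x <= 1)%R,
                {ae cara_measure, forall x, x \in E j -> f j x = 0%R},
                loc_integrable (f j)
              & bmo_norm (f j) <= c%:E].

End outer_measure_on_metric_space.

(* Main.v *)
Require Import Defs.
From HB Require Import structures.
From mathcomp Require Import all_boot all_order all_algebra.
From mathcomp Require Import all_classical all_reals all_analysis.
From mathcomp Require Import measurable_realfun.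
From mathcomp Require Import ring lra zify.

Set Implicit Arguments.
Unset Strict Implicit.
Unset Printing Implicit Defensive.
Import Order.TTheory GRing.Theory Num.Theory.
Import numFieldNormedType.Exports.

Local Open Scope classical_set_scope.
Local Open Scope ring_scope.

(** A density of [E j] that shrinks only geometrically with the scale is what
    both directions measure: passing from a ball to a concentric ball of half
    the radius multiplies a density by at most [cD], so the logarithm of a
    density in base [cD] moves down by at most one unit per dyadic scale, while
    the target functions may move by about [1 / lambda] per unit.

    From the partition to the densities.  If the [f j] sum to 1, then on a given
    ball [B] some [f j] has mean at least [1 / N], although it vanishes almost
    everywhere on [E j].  By Lebesgue density the means of [f j] over small balls
    tend to 0 at almost every point of [E j], and each drop of the mean by a
    multiple of the oscillation bound costs a factor 2 in measure: this is the
    John-Nirenberg inequality, proved by a stopping-time induction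
    ([john_nirenberg]).  With oscillation [c2 / lambda] the number of such drops
    is proportional to [lambda / (N * c2)], so [E j] has density at most
    [2 ^- n] in [B], with [n] proportional to [lambda] ([partition_min_density]).

    From the densities to the partition.  Let [phi j k x] in [0, 1] be a truncated
    and rescaled logarithm of the inverse density of [E j] in the balls about
    [x] of radius at least [2 ^ (- k)] ([level]).  It tends to 0 at almost every
    point of [E j] as [k] grows, and the hypothesis ensures that at each
    scale and each point some [phi j] equals 1 ([level_full]).  View the
    numbers [phi j k x] as capacities: a unit mass is to be split among the
    indices [j] without exceeding the capacities, at all scales [k], and
    moved as lazily as possible when the capacities change.  Handling the
    indices one after the other turns this into one-dimensional problems, for the
    partial sums [cumul phi j], each of which follows a moving interval with the
    least motion.  This is the play operator of hysteresis theory, started at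
    scale [-oo].  Its virtues are that it is nonexpansive for the sup norm over the
    past ([play_lip]), hence nearby points, whose capacities differ by
    [2 / lambda] at all coarser scales, carry nearby distributions, and that it
    moves no more than its interval does ([play_drift]).  The functions sought are
    the limits of the distribution as the scale tends to 0.  On a ball of radius
    about [2 ^ (- k0)] they differ from a constant by [m / lambda] only where some
    capacity has dropped by that much below scale [k0], that is where a density has
    grown by a factor [cD ^+ m]; the weak type inequality for the maximal function
    bounds the measure of this set by a multiple of [cD ^- m] ([drop_set_small]),
    and summing over [m] gives a mean oscillation of order [1 / lambda].

    Both directions rest on a Vitali covering argument ([vitali_bound]) and on the
    density theorem ([almost_all_density_points]). *)

(** * Balls in a doubling space *)
Section doubling_space.
Context {R : realType} {X : completeMetricType R}.
Variable mu : {outer_measure set X -> \bar R}.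
Variable cD : R.
Hypotheses (mu_reg : borel_regular mu) (mu_pos : positive_finite_on_balls mu).
Hypotheses (mu_dbl : doubling mu cD) (cD1 : 1 < cD).

Local Notation cmu := (cara_measure mu).
Local Notation cT := (caratheodory_type mu).

Lemma in_ball (x y : X) (r : R) : ball x r y <-> mdist x y < r.
Proof. by rewrite ballEmdist. Qed.

Lemma ball_mono (x : X) (r s : R) : r <= s -> ball x r `<=` ball x s.
Proof. by move=> rs y; rewrite !in_ball => /lt_le_trans; apply. Qed.

Lemma subset_ball (x y : X) (r s : R) :
  mdist x y + r <= s -> ball y r `<=` ball x s.
Proof.
move=> h z; rewrite !in_ball => yz.
by apply: le_lt_trans (metric_triangle _ y _) _; apply: lt_le_trans h; rewrite ltrD2l.
Qed.

Lemma open_ball (x : X) (r : R) : open (ball x r).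
Proof.
rewrite openE => y; rewrite in_ball => xy; rewrite /interior.
apply/nbhs_ballP; exists (r - mdist x y) => /=; first by rewrite subr_gt0.
by apply: subset_ball; rewrite addrC subrK.
Qed.

Lemma open_cara (U : set X) : open U -> measurable (U : set cT).
Proof. by move=> oU; apply: mu_reg.1; exact: sub_sigma_algebra. Qed.

Lemma cara_measurable_ball (x : X) (r : R) : measurable (ball x r : set cT).
Proof. exact/open_cara/open_ball. Qed.

Lemma mu_ball_fin (x : X) (r : R) : 0 < r -> mu (ball x r) \is a fin_num.
Proof.
by move=> r0; have /andP[a b] := mu_pos x r0; rewrite ge0_fin_numE ?outer_measure_ge0.
Qed.

Lemma mu_ball_gt0 (x : X) (r : R) : 0 < r -> (0 < fine (mu (ball x r))).
Proof. by move=> r0; have h := mu_pos x r0; exact: fine_gt0. Qed.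

Lemma mu_sub_ball_fin (S : set X) (x : X) (r : R) :
  0 < r -> S `<=` ball x r -> mu S \is a fin_num.
Proof.
move=> r0 Sx; have /andP[_ b] := mu_pos x r0.
rewrite ge0_fin_numE ?outer_measure_ge0//.
by apply: le_lt_trans b; exact: le_outer_measure.
Qed.

Lemma mu_dbl_same (x : X) (r : R) : 0 < r ->
  (mu (ball x (2 * r)) <= cD%:E * mu (ball x r))%E.
Proof.
move=> r0; apply: mu_dbl => //; exists x; split; apply/in_ball; rewrite mdistxx//.
by rewrite mulr_gt0.
Qed.

Lemma mu_dbl_iter (n : nat) (x : X) (r : R) : 0 < r ->
  (mu (ball x (2 ^+ n * r)) <= (cD ^+ n)%:E * mu (ball x r))%E.
Proof.
move=> r0; elim: n => [|n IH]; first by rewrite !expr0 mul1r mul1e.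
rewrite exprS -mulrA; apply: (le_trans (mu_dbl_same _ _)).
  by rewrite mulr_gt0// exprn_gt0.
rewrite exprS EFinM -muleA; apply: lee_wpmul2l => //.
by rewrite lee_fin ltW// (lt_trans _ cD1).
Qed.

Lemma sum_disjoint_le (F : nat -> set X) (U : set X) :
  (forall n, measurable (F n : set cT)) -> trivIset setT F ->
  (forall n, F n `<=` U) ->
  (\sum_(n <oo) mu (F n) <= mu U)%E.
Proof.
move=> mF tF FU.
have <- : mu (\bigcup_n F n) = (\sum_(n <oo) mu (F n))%E.
  by rewrite (@measure_semi_bigcup _ _ _ cmu)//; exact: bigcup_measurable.
by apply: le_outer_measure; apply: bigcup_sub => n _; exact: FU.
Qed.

(** By doubling, each ball of radius [t] centred in [ball x0 r] has at least a
    fixed fraction of the measure of [ball x0 r], and only finitely many such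
    disjoint balls fit in [ball x0 (r + t)]. *)
Lemma no_infinite_packing (x0 : X) (r t : R) (s : nat -> X) :
  0 < r -> 0 < t -> (forall n, ball x0 r (s n)) ->
  (forall n m, (n < m)%N -> ball (s n) t `&` ball (s m) t = set0) -> False.
Proof.
move=> r0 t0 sx sdisj.
have [k kP] : exists k, 2 * r <= 2 ^+ k * t.
  exists (Num.bound (2 * r / t)).
  by rewrite -ler_pdivrMr// ltW// (@upper_nthrootP _ (2 * r / t)).
pose c := fine (mu (ball x0 r)) / cD ^+ k.
have cDk : 0 < cD ^+ k by rewrite exprn_gt0// (lt_trans _ cD1).
have c0 : 0 < c by rewrite divr_gt0// mu_ball_gt0.
have hc n : (c%:E <= mu (ball (s n) t))%E.
  have sub : ball x0 r `<=` ball (s n) (2 ^+ k * t).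
    apply: subset_ball; apply: le_trans kP.
    by move: (sx n); rewrite in_ball metric_sym; lra.
  have h := le_trans (le_outer_measure mu _ _ sub) (mu_dbl_iter k (s n) t0).
  rewrite -(fineK (mu_ball_fin (s n) t0)) lee_fin /c ler_pdivrMr//.
  move: h; rewrite -(fineK (mu_ball_fin (s n) t0)) -(fineK (mu_ball_fin x0 r0)).
  by rewrite -EFinM lee_fin mulrC.
pose U := ball x0 (r + t).
have rt0 : 0 < r + t by rewrite addr_gt0.
have h : (\sum_(n <oo) mu (ball (s n) t) <= mu U)%E.
  apply: sum_disjoint_le.
  - by move=> n; exact: cara_measurable_ball.
  - apply/trivIsetP => i j _ _ ij; have [ij'|ij'|ij'] := ltngtP i j.
    + exact: sdisj.
    + by rewrite setIC; exact: sdisj.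
    + by rewrite ij' eqxx in ij.
  - move=> n; apply: subset_ball; move: (sx n); rewrite in_ball; lra.
have [N hN] : exists N : nat, fine (mu U) < c * N%:R.
  exists (Num.truncn (fine (mu U) / c)).+1.
  by rewrite mulrC -ltr_pdivrMr// truncnS_gt.
have : ((c * N%:R)%:E <= mu U)%E.
  apply: le_trans h; apply: (@le_trans _ _ (\sum_(0 <= n < N) mu (ball (s n) t))%E).
    apply: (@le_trans _ _ (\sum_(0 <= n < N) c%:E)%E); last first.
      by apply: lee_sum => n _; exact: hc.
    by rewrite sumEFin sumr_const_nat subn0 mulr_natr.
  by apply: nneseries_lim_ge => n _ _; exact: outer_measure_ge0.
by rewrite -(fineK (mu_ball_fin x0 rt0)) lee_fin leNgt hN.
Qed.

(** * Vitali coverings by balls of dyadic radii *)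

Section vitali.
Variables (A : set X) (x0 : X) (r r1 : R) (lev : X -> nat).
Hypotheses (r0 : 0 < r) (r10 : 0 < r1) (Ax0 : A `<=` ball x0 r1).

Let rho (x : X) : R := r / 2 ^+ lev x.

Let rho_gt0 x : 0 < rho x. Proof. by rewrite divr_gt0// exprn_gt0. Qed.

Let rho_le x y : (lev x <= lev y)%N -> rho y <= rho x.
Proof.
move=> xy; rewrite ler_pM2l// lef_pV2 ?posrE ?exprn_gt0//.
by rewrite ler_weXn2l// ler1n.
Qed.

(* The selection is greedy: [l] lists the centres chosen so far, and the next
   centre is a candidate of least level, that is of largest radius. *)
Let cand (l : seq X) (y : X) :=
  A y /\ forall z, z \in l -> ball y (rho y) `&` ball z (rho z) = set0.

Let pick_spec (l : seq X) (o : option X) :=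
  if o is Some y then cand l y /\ (forall z, cand l z -> (lev y <= lev z)%N)
  else forall z, ~ cand l z.

Let pickP l : exists o, pick_spec l o.
Proof.
have [[y0 cy0]|/forallNP h] := pselect (exists y, cand l y); last by exists None.
have exn : exists n, `[< exists2 z, cand l z & lev z = n >].
  by exists (lev y0); apply/asboolP; exists y0.
have [n /asboolP[z cz zn] nmin] := ex_minnP exn.
exists (Some z); split=> // y cy; rewrite zn; apply: nmin; apply/asboolP.
by exists y.
Qed.

(** The radii being dyadic, the candidates have a largest radius at each step.  A
    centre [y] left out was blocked by a ball that is at least as large and meets
    its own, so [y] lies in the ball of twice the radius.  The selection cannot
    keep choosing radii at least [rho y] for ever, by [no_infinite_packing].
    The value [None] means that no candidate is left. *)
Lemma vitali_dyadic : exists s : nat -> option X,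
  [/\ forall n y, s n = Some y -> A y,
      forall n m y z, n <> m -> s n = Some y -> s m = Some z ->
        ball y (rho y) `&` ball z (rho z) = set0 &
      forall y, A y -> exists n z, s n = Some z /\ ball z (2 * rho z) y].
Proof.
have [pick hpick] := choice pickP.
pose chain := fix chain (n : nat) : seq X :=
  if n is m.+1 then
    (if pick (chain m) is Some y then y :: chain m else chain m) else [::].
pose s n := pick (chain n).
have chainS n : chain n.+1 = if s n is Some y then y :: chain n else chain n by [].
have chain_sub n m : (n <= m)%N -> {subset chain n <= chain m}.
  move=> /subnK <-; elim: (m - n)%N => [|k IH] // z /IH zk.
  by rewrite addSn chainS; case: (s _) => // y; rewrite inE zk orbT.
have sA n y : s n = Some y -> A y.
  by move=> sn; have := hpick (chain n); rewrite -/(s n) sn => -[[]].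
have in_chain n m y : s n = Some y -> (n < m)%N -> y \in chain m.
  by move=> sn nm; apply: (chain_sub _ _ nm); rewrite chainS sn mem_head.
have sdisj_lt n m y z : (n < m)%N -> s n = Some y -> s m = Some z ->
    ball y (rho y) `&` ball z (rho z) = set0.
  move=> nm sn sm; have := hpick (chain m); rewrite -/(s m) sm => -[[_ h] _].
  by rewrite setIC; apply: h; exact: in_chain nm.
have sdisj n m y z : n <> m -> s n = Some y -> s m = Some z ->
    ball y (rho y) `&` ball z (rho z) = set0.
  move=> /eqP; rewrite neq_ltn => /orP[nm|nm] sn sm.
    exact: sdisj_lt nm sn sm.
  by rewrite setIC; exact: sdisj_lt nm sm sn.
exists s; split => // y Ay.
(* Otherwise [y] would be a candidate for ever, and all the balls chosen would
   have radius at least [rho y]. *)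
have [n ncand] : exists n, ~ cand (chain n) y.
  apply/existsNP => allc.
  have ch n : exists z, s n = Some z /\ (lev z <= lev y)%N.
    have := hpick (chain n); rewrite -/(s n).
    case: (s n) => [z [_ h]|/(_ y)]; last by move/(_ (allc n)).
    by exists z; split=> //; exact: h.
  have [z hz] := choice ch.
  apply: (@no_infinite_packing x0 r1 (rho y) z) => //.
    by move=> n; apply: Ax0; apply: sA (hz n).1.
  move=> n m nm; apply/seteqP; split=> // w [wn wm].
  rewrite -(sdisj_lt _ _ _ _ nm (hz n).1 (hz m).1); split.
    by apply: ball_mono wn; exact: rho_le (hz n).2.
  by apply: ball_mono wm; exact: rho_le (hz m).2.
(* At the first step where [y] ceases to be a candidate, the ball just chosen
   meets that of [y], and its level was at most that of [y]. *)
have exn : exists n, `[< ~ cand (chain n) y >] by exists n; apply/asboolP.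
have [[|k] /asboolP kc kmin] := ex_minnP exn.
  by exfalso; apply: kc; split.
have ck : cand (chain k) y.
  apply: contrapT => h; have := kmin k (introT (asboolP _) h).
  by rewrite ltnn.
have := hpick (chain k); rewrite -/(s k); case sk : (s k) => [z|]; last by move/(_ y); move/(_ ck).
move=> [_ /(_ y ck) zy]; exists k, z; split => //.
have [w [wy wz]] : ball y (rho y) `&` ball z (rho z) !=set0.
  apply/set0P/eqP => h; apply: kc; split=> // w; rewrite chainS sk inE.
  by move=> /orP[/eqP->//|]; exact: ck.2.
move: wy wz; rewrite !in_ball => wy wz; apply: le_lt_trans (metric_triangle _ w _) _.
rewrite mulr_natl mulr2n; apply: ltrD => //; rewrite metric_sym.
by apply: lt_le_trans wy _; exact: rho_le.
Qed.

(** The common form of the three covering estimates below: the density theorem,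
    the stopping-time argument and the weak type inequality differ only in the
    density [g] that controls [A] locally. *)
Lemma vitali_bound (g : cT -> R) (U : set cT) :
  measurable U -> measurable_fun U g -> (forall x, 0 <= g x) ->
  (forall x, A x -> ball x (rho x) `<=` U) ->
  (forall x, A x -> mu (A `&` ball x (2 * rho x)) <=
                    \int[cmu]_(y in ball x (rho x)) (g y)%:E)%E ->
  (mu A <= \int[cmu]_(y in U) (g y)%:E)%E.
Proof.
move=> mU mg g0 AU Ag.
have [s [sA sdisj scover]] := vitali_dyadic.
pose F n : set cT := if s n is Some y then ball y (rho y) else set0.
pose G n : set X := if s n is Some y then A `&` ball y (2 * rho y) else set0.
have mF n : measurable (F n).
  by rewrite /F; case: (s n) => // y; exact: cara_measurable_ball.
have tF : trivIset setT F.
  apply/trivIsetP => n m _ _ /eqP nm; rewrite /F.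
  case sn : (s n) => [y|]; last by rewrite set0I.
  case sm : (s m) => [z|]; last by rewrite setI0.
  exact: sdisj nm sn sm.
have FU : \bigcup_n F n `<=` U.
  apply: bigcup_sub => n _; rewrite /F; case sn : (s n) => [y|] //.
  by apply: AU; exact: sA sn.
have AG : A `<=` \bigcup_n G n.
  move=> y Ay; have [n [z [sn zy]]] := scover _ Ay.
  by exists n => //; rewrite /G sn.
apply: le_trans (le_outer_measure mu _ _ AG) _.
apply: le_trans (outer_measure_sigma_subadditive mu G) _.
apply: (@le_trans _ _ (\sum_(n <oo) \int[cmu]_(y in F n) (g y)%:E)%E).
  apply: lee_nneseries => [n _ _|n _]; first exact: outer_measure_ge0.
  rewrite /G /F; case sn : (s n) => [y|]; last by rewrite outer_measure0 integral_set0.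
  by apply: Ag; exact: sA sn.
rewrite -ge0_integral_bigcup//.
- apply: ge0_subset_integral => //.
  + exact: bigcup_measurable.
  + exact/measurable_EFinP.
  + by move=> x _; rewrite lee_fin.
- by apply/measurable_EFinP; apply: measurable_funS mg.
- by move=> x _; rewrite lee_fin.
Qed.

End vitali.

(** * Outer regularity and density points *)
Lemma decreasing_small (F : nat -> set X) (eta : R) :
  (forall n, measurable (F n : set cT)) -> (mu (F 0%N) < +oo)%E ->
  nonincreasing_seq F -> (mu (\bigcap_n F n) < eta%:E)%E ->
  exists n, (mu (F n) < eta%:E)%E.
Proof.
move=> mF F0 dF Feta.
have cv := @nonincreasing_cvg_mu _ _ _ cmu F F0 mF
  (bigcap_measurable (ex_intro _ 0%N I) (fun i _ => mF i)) dF.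
have oN : open_nbhs (mu (\bigcap_n F n)) [set y : \bar R | (y < eta%:E)%E].
  by split => //; exact: open_ereal_lt_ereal.
have [n _ hn] := cv _ (open_nbhs_nbhs oN).
by exists n; apply: hn => /=.
Qed.

(** Regularity of [S] inside [B0], with [V] standing for the complement of a closed
    subset of [S]: this makes the notion visibly stable under complement. *)
Definition approximable (B0 S : set X) :=
  forall eta : R, 0 < eta -> exists U V : set X,
    [/\ open U, open V, S `<=` U, ~` S `<=` V & (mu (U `&` V `&` B0) < eta%:E)%E].

Lemma approximable_setC B0 S : approximable B0 S -> approximable B0 (~` S).
Proof.
move=> h eta e0; have [U [V [oU oV SU SV UV]]] := h _ e0.
by exists V, U; split => //; rewrite ?setCK// (setIC V).
Qed.

(** An open set is the increasing union of the closed sets of its points at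
    distance at least [n.+1%:R^-1] from the complement. *)
Lemma approximable_open B0 S : measurable (B0 : set cT) -> (mu B0 < +oo)%E ->
  open S -> approximable B0 S.
Proof.
move=> mB0 B0oo oS eta eta0.
pose V n := \bigcup_(y in ~` S) ball y n.+1%:R^-1.
have oV n : open (V n) by apply: bigcup_open => y _; exact: open_ball.
have [n hn] : exists n, (mu (S `&` V n `&` B0) < eta%:E)%E.
  apply: (@decreasing_small (fun n => S `&` V n `&` B0)).
  - by move=> n; apply: measurableI => //; apply: measurableI; exact: open_cara.
  - by apply: le_lt_trans B0oo; apply: le_outer_measure.
  - apply/nonincreasing_seqP => n; apply/subsetPset.
    apply: setSI; apply: setIS; apply: subset_bigcup => y _.
    apply: ball_mono; rewrite lef_pV2 ?posrE//.
    by rewrite ler_nat.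
  - rewrite (_ : \bigcap_n _ = set0) ?outer_measure0 ?lte_fin//.
    rewrite -subset0 => x Fx.
    have Sx : S x by have [[]] := Fx 0%N I.
    move: oS; rewrite openE => /(_ _ Sx)/nbhs_ballP[e /= e0 eS].
    have [k hk] := ltr_add_invr e0; rewrite add0r in hk.
    have [[_ [y Sy yx]] _] := Fx k I; apply: Sy; apply: eS.
    by apply: ball_sym; apply: ball_mono yx; exact: ltW.
exists S, (V n); split => // y Sy; exists y => //.
by apply/in_ball; rewrite mdistxx invr_gt0.
Qed.

(** The complement of the union needs an open neighbourhood, but the intersection
    of all the [V n] is not open; finitely many suffice up to a small measure. *)
Lemma approximable_bigcup B0 (S : nat -> set X) :
  measurable (B0 : set cT) -> (mu B0 < +oo)%E ->
  (forall n, approximable B0 (S n)) -> approximable B0 (\bigcup_n S n).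
Proof.
move=> mB0 B0oo hS eta eta0.
have eta20 : 0 < eta / 2 by rewrite divr_gt0.
have hn n : exists UV : set X * set X,
    [/\ open UV.1, open UV.2, S n `<=` UV.1, ~` S n `<=` UV.2 &
       (mu (UV.1 `&` UV.2 `&` B0) <= ((eta / 2) / (2 ^ n.+1)%:R)%:E)%E].
  have h0 : 0 < (eta / 2) / (2 ^ n.+1)%:R by rewrite divr_gt0// ltr0n expn_gt0.
  by have [U [V [? ? ? ? /ltW ?]]] := hS n _ h0; exists (U, V).
have [W hW] := choice hn.
pose U := \bigcup_n (W n).1; pose V n := \bigcap_(i in `I_n.+1) (W i).2.
have oU : open U by apply: bigcup_open => n _; have [] := hW n.
have oV n : open (V n).
  rewrite /V bigcap_mkord; apply: big_ind; [exact: openT|exact: openI|].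
  by move=> i _; have [] := hW i.
have [n hn'] : exists n, (mu (U `&` V n `&` B0) < eta%:E)%E.
  apply: (@decreasing_small (fun n => U `&` V n `&` B0)).
  - by move=> n; apply: measurableI => //; apply: measurableI; exact: open_cara.
  - by apply: le_lt_trans B0oo; apply: le_outer_measure.
  - apply/nonincreasing_seqP => n; apply/subsetPset.
    apply: setSI; apply: setIS => y Vy i /= iN; apply: Vy => /=.
    exact: ltnW.
  - apply: (@le_lt_trans _ _ (eta / 2)%:E); last first.
      by rewrite lte_fin ltr_pdivrMr// ltr_pMr// ltr1n.
    apply: le_trans (epsilon_trick0 xpredT (ltW eta20)).
    apply: (@le_trans _ _ (\sum_(i <oo) mu ((W i).1 `&` (W i).2 `&` B0))%E).
      apply: le_trans (outer_measure_sigma_subadditive mu _).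
      apply: le_outer_measure => x Fx.
      have [[[i _ Ui] _] B0x] := Fx 0%N I.
      exists i => //; split=> //; split => //.
      by have [[_ Vx] _] := Fx i I; apply: Vx => /=.
    apply: lee_nneseries => [i _ _|i _]; first exact: outer_measure_ge0.
    by have [] := hW i.
exists U, (V n); split => //.
  by apply: subset_bigcup => i _; have [] := hW i.
move=> x Sx i _; have [_ _ _ h _] := hW i; apply: h => Six; apply: Sx.
by exists i.
Qed.

Lemma borel_approximable (B0 S : set X) :
  measurable (B0 : set cT) -> (mu B0 < +oo)%E -> borel S -> approximable B0 S.
Proof.
move=> mB0 B0oo; apply: smallest_sub; last first.
  by move=> U oU; exact: approximable_open.
split.
- by apply: approximable_open => //; exact: open0.
- by move=> A hA; rewrite setTD; exact: approximable_setC.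
- by move=> F hF; exact: approximable_bigcup.
Qed.

Lemma outer_regular_in_ball (E : set X) (x0 : X) (r eta : R) :
  measurable (E : set cT) -> 0 < r -> 0 < eta ->
  exists2 U : set X, open U & E `&` ball x0 r `<=` U /\
    (mu (U `&` ball x0 r `\` E) <= eta%:E)%E.
Proof.
move=> mE r0 eta0; set B0 := ball x0 r.
have mB0 : measurable (B0 : set cT) by exact: cara_measurable_ball.
have B0oo : (mu B0 < +oo)%E by have /andP[] := mu_pos x0 r0.
have [S [bS ES muS]] := mu_reg.2 (E `&` B0).
have mS : measurable (S : set cT) by exact: mu_reg.1.
have mEB0 : measurable (E `&` B0 : set cT) by exact: measurableI.
have [U [V [oU oV SU SV UV]]] := borel_approximable mB0 B0oo bS eta0.
exists U => //; split; first exact: subset_trans SU.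
have S0 : mu (S `\` (E `&` B0)) = 0%E.
  have Efin : mu (E `&` B0) \is a fin_num.
    by apply: (mu_sub_ball_fin r0); exact: subIsetr.
  have := mEB0 S; rewrite setDE muS (setIidr ES) -(fineK Efin).
  case: (mu (S `&` ~` (E `&` B0))) => [t| |]//.
  by rewrite -EFinD => -[/eqP]; rewrite -subr_eq0 opprD addrA subrr sub0r oppr_eq0 => /eqP ->.
apply: (@le_trans _ _ (mu ((U `&` V `&` B0) `|` (S `\` (E `&` B0))))).
  apply: le_outer_measure => y [[Uy By] Ey].
  have [Sy|Sy] := pselect (S y); [right|left]; last by split=> //; split => //; exact: SV.
  by split => // -[].
apply: (le_trans (outer_measureU2 mu _ _)).
by rewrite S0 adde0 ltW.
Qed.

Lemma integral_scaled_indic (E S : set cT) (c : R) :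
  measurable E -> measurable S -> 0 <= c ->
  (\int[cmu]_(y in S) (c * \1_E y)%:E = c%:E * mu (E `&` S))%E.
Proof.
move=> mE mS c0; under eq_integral do rewrite EFinM.
rewrite ge0_integralZl_EFin//; last exact/measurable_EFinP.
by rewrite integral_indic.
Qed.

Lemma null_bigcup (F : nat -> set X) :
  (forall n, mu (F n) = 0%E) -> mu (\bigcup_n F n) = 0%E.
Proof.
move=> F0; apply/eqP; rewrite eq_le outer_measure_ge0 andbT.
apply: le_trans (outer_measure_sigma_subadditive mu F) _.
by rewrite eseries0.
Qed.

Lemma null_measurable (Z : set X) : mu Z = 0%E -> measurable (Z : set cT).
Proof.
move=> Z0; apply: le_caratheodory_measurable => A.
have -> : mu (A `&` Z) = 0%E.
  apply/eqP; rewrite eq_le outer_measure_ge0 andbT -Z0.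
  by apply: le_outer_measure; exact: subIsetr.
by rewrite add0e; apply: le_outer_measure; exact: subIsetl.
Qed.

Lemma outer_measure_bigsetU_le (I : Type) (s : seq I) (F : I -> set X) :
  (mu (\big[setU/set0]_(i <- s) F i) <= \sum_(i <- s) mu (F i))%E.
Proof.
elim: s => [|i s IH]; first by rewrite !big_nil outer_measure0.
rewrite !big_cons; apply: le_trans (outer_measureU2 mu _ _) _.
exact: leeD2l.
Qed.

(** Cover the exceptional set by balls inside an open set [U] that barely exceeds
    [E]: in each the complement of [E] has a proportion [delta], so the balls
    have total measure at most [mu (U `\` E) / delta]. *)
Lemma low_density_points_null (E : set X) (x0 : X) (r r1 delta : R) :
  measurable (E : set cT) -> 0 < r -> 0 < r1 -> 0 < delta ->
  mu [set x | [/\ E x, ball x0 r1 x & forall i, exists2 k, (i <= k)%N &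
    (delta%:E * mu (ball x (r / 2 ^+ k)) < mu (ball x (r / 2 ^+ k) `\` E))%E]] = 0%E.
Proof.
move=> mE r0 r10 d0; set A := [set x | _].
have cD0 : 0 < cD by rewrite (lt_trans _ cD1).
apply/eqP; rewrite eq_le outer_measure_ge0 andbT; apply/lee_addgt0Pr => e e0.
rewrite add0e.
have eta0 : 0 < e * (delta / cD) by rewrite mulr_gt0// divr_gt0.
have [U oU [EU muU]] := outer_regular_in_ball x0 mE r10 eta0.
have hlev x : exists k, A x -> ball x (r / 2 ^+ k) `<=` U `&` ball x0 r1 /\
    (delta%:E * mu (ball x (r / 2 ^+ k)) < mu (ball x (r / 2 ^+ k) `\` E))%E.
  have [Ax|] := pselect (A x); last by exists 0%N.
  case: (Ax) => Ex x0x bad.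
  have : open (U `&` ball x0 r1) by apply: openI => //; exact: open_ball.
  rewrite openE => /(_ x (conj (EU _ (conj Ex x0x)) x0x))/nbhs_ballP[t /= t0 tU].
  have [k ik hk] := bad (Num.bound (r / t)).
  exists k => _; split => //; apply: subset_trans tU; apply: ball_mono.
  rewrite ler_pdivrMr ?exprn_gt0// mulrC -ler_pdivrMr// ltW//.
  exact: upper_nthrootP.
have [lev hl] := choice hlev.
have Ax0 : A `<=` ball x0 r1 by move=> x [].
have mUB : measurable (U `&` ball x0 r1 : set cT).
  by apply: measurableI; [exact: open_cara|exact: cara_measurable_ball].
have cd0 : 0 <= cD / delta by rewrite divr_ge0// ltW.
have mEC : measurable (~` E : set cT) by exact: measurableC.
apply: (@le_trans _ _ (\int[cmu]_(y in (U `&` ball x0 r1 : set cT))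
    ((cD / delta) * \1_(~` E : set cT) y)%:E)%E).
  apply: (vitali_bound r0 r10 Ax0) => //.
  - by apply: measurable_funM => //; exact: measurable_indic.
  - by move=> x; rewrite mulr_ge0//.
  - by move=> x Ax; exact: (hl x Ax).1.
  move=> x Ax; have [_ /ltW h] := hl x Ax.
  rewrite integral_scaled_indic//; last exact: cara_measurable_ball.
  apply: (@le_trans _ _ (mu (ball x (2 * (r / 2 ^+ lev x)))%R)).
    by apply: le_outer_measure => y [].
  apply: (le_trans (mu_dbl_same _ _)); first by rewrite divr_gt0// exprn_gt0.
  rewrite EFinM -muleA; apply: lee_wpmul2l; first by rewrite lee_fin ltW.
  rewrite lee_pdivlMl//; apply: le_trans h _.
  by rewrite setDE setIC.
rewrite integral_scaled_indic//.
apply: (@le_trans _ _ ((cD / delta)%:E * (e * (delta / cD))%:E)%E).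
  by apply: lee_wpmul2l; rewrite ?lee_fin// setIC -setDE.
rewrite -EFinM lee_fin le_eqVlt; apply/orP; left; apply/eqP; field.
by rewrite !gt_eqF.
Qed.

(** Lebesgue's density theorem along the scales [r / 2 ^+ i].  One index [n] serves
    both for the proportion and for a ball exhausting the space. *)
Lemma almost_all_density_points (E : set X) (r : R) :
  measurable (E : set cT) -> 0 < r ->
  exists2 Z : set X, mu Z = 0%E & forall x, E x -> ~ Z x ->
    forall delta : R, 0 < delta -> exists i0, forall i, (i0 <= i)%N ->
      (mu (ball x (r / 2 ^+ i) `\` E) <= delta%:E * mu (ball x (r / 2 ^+ i)))%E.
Proof.
move=> mE r0; pose F (n : nat) := [set x | [/\ E x, ball (point : X) n.+1%:R x &
  forall i, exists2 k, (i <= k)%N &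
  (n.+1%:R^-1%:E * mu (ball x (r / 2 ^+ k)) < mu (ball x (r / 2 ^+ k) `\` E))%E]].
exists (\bigcup_n F n).
  by apply: null_bigcup => n; apply: low_density_points_null => //; rewrite ?invr_gt0.
move=> x Ex Zx delta d0.
have [n hn] := ltr_add_invr d0; rewrite add0r in hn.
pose m := maxn n (Num.truncn (mdist (point : X) x)).
have : ~ F m x by move=> Fm; apply: Zx; exists m.
move=> /not_and3P[] //.
  move/in_ball => h; exfalso; apply: h; apply: lt_le_trans (truncnS_gt _) _.
  by rewrite ler_nat ltnS leq_maxr.
move=> /existsNP[i0 h]; exists i0 => i i0i.
rewrite leNgt; apply/negP => hi; apply: h; exists i => //.
apply: le_lt_trans hi; apply: lee_wpmul2r; first exact: outer_measure_ge0.
rewrite lee_fin; apply: le_trans (ltW hn); rewrite lef_pV2 ?posrE//.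
by rewrite ler_nat ltnS leq_maxl.
Qed.

(** * Means over balls and mean oscillation *)
Lemma loc_integrable_bounded (f : X -> R) (M : R) :
  measurable_fun [set: cT] f -> (forall x, `|f x| <= M) -> loc_integrable mu f.
Proof.
move=> mf fM; split=> // x r r0.
apply: (@measurable_bounded_integrable _ cT R cmu f (ball x r)).
- exact: cara_measurable_ball.
- by have /andP[] := mu_pos x r0.
- exact: measurable_funS mf.
- by exists M; split; [exact: num_real|move=> M' MM' y _; apply: le_trans (fM y) (ltW MM')].
Qed.

Lemma loc_integrable_cst (c : R) : loc_integrable mu (cst c).
Proof. exact: (@loc_integrable_bounded _ `|c|). Qed.

Lemma loc_integrableD (f g : X -> R) : loc_integrable mu f ->
  loc_integrable mu g -> loc_integrable mu (fun x => f x + g x).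
Proof.
move=> [mf If] [mg Ig]; split; first exact: measurable_funD.
move=> x r r0; have mB := cara_measurable_ball x r.
exact: integrableD (If _ _ r0) (Ig _ _ r0).
Qed.

Lemma loc_integrable_subc (f : X -> R) (c : R) :
  loc_integrable mu f -> loc_integrable mu (fun x => f x - c).
Proof. by move=> lf; exact: loc_integrableD lf (loc_integrable_cst (- c)). Qed.

Lemma loc_integrable_norm (f : X -> R) :
  loc_integrable mu f -> loc_integrable mu (fun x => `|f x|).
Proof.
move=> [mf If]; split; first by apply: measurableT_comp mf.
move=> x r r0; exact: integrable_norm (If _ _ r0).
Qed.

Lemma ball_mean_ge0 (f : X -> R) x r : (forall y, 0 <= f y) -> 0 <= ball_mean mu f x r.
Proof.
move=> f0; apply: mulr_ge0; last by apply: Rintegral_ge0.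
by rewrite invr_ge0 fine_ge0// outer_measure_ge0.
Qed.

Lemma ball_mean_le (f g : X -> R) x r : 0 < r ->
  loc_integrable mu f -> loc_integrable mu g ->
  (forall y, ball x r y -> f y <= g y) -> ball_mean mu f x r <= ball_mean mu g x r.
Proof.
move=> r0 [_ If] [_ Ig] fg; rewrite ler_wpM2l ?invr_ge0 ?fine_ge0 ?outer_measure_ge0//.
apply: le_Rintegral => //; [exact: cara_measurable_ball|exact: If|exact: Ig].
Qed.

Lemma ball_mean_cst (c : R) x r : 0 < r -> ball_mean mu (cst c) x r = c.
Proof.
move=> r0; rewrite /ball_mean Rintegral_cst; last exact: cara_measurable_ball.
by rewrite mulrCA mulVf ?mulr1// gt_eqF// mu_ball_gt0.
Qed.

Lemma ball_meanD (f g : X -> R) x r : 0 < r ->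
  loc_integrable mu f -> loc_integrable mu g ->
  ball_mean mu (fun y => f y + g y) x r = ball_mean mu f x r + ball_mean mu g x r.
Proof.
move=> r0 [_ If] [_ Ig]; rewrite /ball_mean RintegralD ?mulrDr//.
- exact: cara_measurable_ball.
- exact: If.
- exact: Ig.
Qed.

Lemma ball_mean_subc (f : X -> R) (c : R) x r : 0 < r -> loc_integrable mu f ->
  ball_mean mu (fun y => f y - c) x r = ball_mean mu f x r - c.
Proof.
move=> r0 lf; rewrite (ball_meanD x r0 lf (loc_integrable_cst (- c))).
by rewrite (ball_mean_cst (- c)).
Qed.

Lemma ball_mean_dist (f : X -> R) (c : R) x r : 0 < r -> loc_integrable mu f ->
  `|ball_mean mu f x r - c| <= ball_mean mu (fun y => `|f y - c|) x r.
Proof.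
move=> r0 lf; rewrite -ball_mean_subc// /ball_mean normrM gtr0_norm; last first.
  by rewrite invr_gt0 mu_ball_gt0.
rewrite ler_wpM2l ?invr_ge0 ?fine_ge0 ?outer_measure_ge0//.
apply: le_normr_Rintegral; first exact: cara_measurable_ball.
exact: (loc_integrable_subc c lf).2.
Qed.

Lemma integral_ballE (g : X -> R) x r : 0 < r -> loc_integrable mu g ->
  (\int[cmu]_(y in ball x r) (g y)%:E = (ball_mean mu g x r)%:E * mu (ball x r))%E.
Proof.
move=> r0 [_ Ig]; rewrite -(fineK (mu_ball_fin x r0)) -EFinM /ball_mean mulrC mulrA.
rewrite divff ?mul1r ?gt_eqF ?mu_ball_gt0// /Rintegral fineK//.
by apply: integrable_fin_num; [exact: cara_measurable_ball|exact: Ig].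
Qed.

Lemma integral_ball_scaled (g : X -> R) (c : R) x r : 0 < r -> 0 <= c ->
  loc_integrable mu g -> (forall y, 0 <= g y) ->
  (\int[cmu]_(y in ball x r) (c * g y)%:E =
   (c * ball_mean mu g x r)%:E * mu (ball x r))%E.
Proof.
move=> r0 c0 lg g0; under eq_integral do rewrite EFinM.
rewrite ge0_integralZl_EFin//; first by rewrite integral_ballE// muleA.
- exact: cara_measurable_ball.
- by move=> y _; rewrite lee_fin.
- by apply/measurable_EFinP; apply: measurable_funS lg.1.
Qed.

Lemma ball_mean_sub_ball (g : X -> R) x y r s (k : R) : 0 < r -> 0 < s ->
  loc_integrable mu g -> (forall z, 0 <= g z) -> ball y s `<=` ball x r ->
  (mu (ball x r) <= k%:E * mu (ball y s))%E ->
  ball_mean mu g y s <= k * ball_mean mu g x r.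
Proof.
move=> r0 s0 lg g0 yx; rewrite -(fineK (mu_ball_fin x r0)) -(fineK (mu_ball_fin y s0)).
rewrite -EFinM lee_fin => hk.
have hI : ball_mean mu g y s * fine (mu (ball y s)) <= ball_mean mu g x r * fine (mu (ball x r)).
  rewrite -lee_fin !EFinM (fineK (mu_ball_fin x r0)) (fineK (mu_ball_fin y s0)).
  rewrite -(integral_ballE x r0 lg) -(integral_ballE y s0 lg).
  apply: ge0_subset_integral => //; [exact: cara_measurable_ball|exact: cara_measurable_ball| |].
    by apply/measurable_EFinP; apply: measurable_funS lg.1.
  by move=> z _; rewrite lee_fin.
have h0 := ball_mean_ge0 x r g0.
have p := mu_ball_gt0 y s0.
move: (ball_mean mu g x r) (ball_mean mu g y s) h0 hI => a b h0 hI.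
rewrite -(ler_pM2r p); apply: (le_trans hI).
by rewrite [k * _]mulrC -mulrA; apply: ler_wpM2l.
Qed.

(** The real-valued form of [mean_oscillation], see [mean_oscillationE]. *)
Definition osc (f : X -> R) x r := ball_mean mu (fun y => `|f y - ball_mean mu f x r|) x r.

Lemma mean_oscillationE (f : X -> R) x r : 0 < r -> loc_integrable mu f ->
  mean_oscillation mu f x r = (osc f x r)%:E.
Proof.
move=> r0 lf; rewrite /mean_oscillation integral_ballE//; last first.
  exact/loc_integrable_norm/loc_integrable_subc.
rewrite -/(osc f x r); move: (osc f x r) => a.
rewrite -(fineK (mu_ball_fin x r0)) inver gt_eqF ?mu_ball_gt0//.
by rewrite -!EFinM mulrCA mulVf ?mulr1// gt_eqF// mu_ball_gt0.
Qed.

Lemma bmo_norm_leP (f : X -> R) (c : R) : loc_integrable mu f ->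
  (bmo_norm mu f <= c%:E)%E <-> forall x r, 0 < r -> osc f x r <= c.
Proof.
move=> lf; split=> [h x r r0|h].
  rewrite -lee_fin -mean_oscillationE//; apply: le_trans h.
  by apply: ereal_sup_ubound; exists x, r.
apply: ge_ereal_sup => _ [x [r [r0 ->]]].
by rewrite mean_oscillationE// lee_fin h.
Qed.

Lemma osc_le (f : X -> R) (c : R) x r : 0 < r -> loc_integrable mu f ->
  osc f x r <= 2 * ball_mean mu (fun y => `|f y - c|) x r.
Proof.
move=> r0 lf; set m := ball_mean mu f x r.
have lc := loc_integrable_norm (loc_integrable_subc c lf).
have lm := loc_integrable_norm (loc_integrable_subc m lf).
have lk := loc_integrable_cst (`|m - c|).
have hm := ball_mean_dist c x r0 lf.
apply: (@le_trans _ _ (ball_mean mu (fun y => `|f y - c| + cst `|m - c| y) x r)).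
  apply: ball_mean_le => // [|y _ /=]; first exact: loc_integrableD.
  by rewrite -[f y - _](subrKA c) (le_trans (ler_normD _ _))// lerD2l distrC.
rewrite (ball_meanD x r0 lc lk) (ball_mean_cst _ _ r0).
by move: hm; rewrite -/m; move: (ball_mean mu _ x r) => a; lra.
Qed.

(** * Exponential decay on the zero set of a function of small oscillation *)

Section john_nirenberg.
Variables (f : X -> R) (eps r : R) (S : set X).
Hypotheses (lf : loc_integrable mu f) (eps0 : 0 < eps) (r0 : 0 < r).
Hypothesis f_osc : forall x t, 0 < t -> osc f x t <= eps.
Hypothesis S_mean : forall y, S y -> forall delta : R, 0 < delta ->
  exists i0, forall i, (i0 <= i)%N -> ball_mean mu f y (r / 2 ^+ i) <= delta.

Definition jn_const := 4 * cD ^+ 2 * (1 + cD).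

Let cD0 : 0 < cD. Proof. exact: lt_trans cD1. Qed.

Lemma ball_mean_double (x : X) (t : R) : 0 < t ->
  ball_mean mu (fun z => `|f z - ball_mean mu f x t|) x (2 * t) <= (1 + cD) * eps.
Proof.
move=> t0; have t20 : 0 < 2 * t by rewrite mulr_gt0.
set m := ball_mean mu f x t; set m2 := ball_mean mu f x (2 * t).
have l2 := loc_integrable_norm (loc_integrable_subc m2 lf).
have hm : `|m - m2| <= cD * eps.
  apply: (le_trans (ball_mean_dist m2 x t0 lf)).
  apply: (@le_trans _ _ (cD * osc f x (2 * t))).
    apply: ball_mean_sub_ball => //.
    - by apply: ball_mono; rewrite ler_peMl ?ler1n// ltW.
    - exact: mu_dbl_same.
  by rewrite ler_pM2l// f_osc.
have l1 := loc_integrable_norm (loc_integrable_subc m lf).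
apply: (@le_trans _ _ (ball_mean mu (fun z => `|f z - m2| + cst (cD * eps) z) x (2 * t))).
  apply: ball_mean_le => //.
    exact: loc_integrableD l2 (loc_integrable_cst _).
  move=> z _ /=; rewrite -[f z - m](subrKA m2) (le_trans (ler_normD _ _))//.
  by rewrite lerD2l distrC.
rewrite (ball_meanD x t20 l2 (loc_integrable_cst _)) (ball_mean_cst _ _ t20).
have := f_osc x t20; rewrite /osc -/m2; move: (ball_mean mu _ x _) => a; lra.
Qed.

(** If the mean of [f] over a ball is at least [n] steps above 0, a point of [S],
    where the means tend to 0, has a first dyadic scale at which the mean of
    [g = `|f - m|] exceeds [tau], half a step.  One scale earlier it did not, so the
    mean of [f] over that ball is still [n - 1] steps above 0 and induction applies
    there.  The stopped balls have total measure at most the integral of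
    [g] divided by [tau], and [jn_const] is chosen so that this, with the constants
    lost to doubling, gains the factor [1 / 2]. *)
Lemma john_nirenberg (n : nat) (x : X) (i : nat) :
  n%:R * (jn_const * eps) <= ball_mean mu f x (r / 2 ^+ i) ->
  (mu (S `&` ball x (r / 2 ^+ i)) <= (2 ^- n)%:E * mu (ball x (r / 2 ^+ i)))%E.
Proof.
elim: n x i => [|n IH] x i.
  by rewrite expr0 invr1 mul1e => _; apply: le_outer_measure.
set t := r / 2 ^+ i; set m := ball_mean mu f x t => hm.
have t0 : 0 < t by rewrite divr_gt0// exprn_gt0.
have t20 : 0 < 2 * t by rewrite mulr_gt0.
pose g z := `|f z - m|.
have lg : loc_integrable mu g by apply/loc_integrable_norm/loc_integrable_subc.
have g0 z : 0 <= g z by exact: normr_ge0.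
have hg2 : ball_mean mu g x (2 * t) <= (1 + cD) * eps by exact: ball_mean_double.
pose tau := 2 * cD ^+ 2 * (1 + cD) * eps.
have ce0 : 0 < (1 + cD) * eps by rewrite mulr_gt0// ltr_wpDr// ltW.
have tau0 : 0 < tau by rewrite /tau -mulrA mulr_gt0// mulr_gt0// exprn_gt0.
have tauE : jn_const * eps = 2 * tau by rewrite /jn_const /tau; ring.
rewrite tauE in hm IH.
have tk k : t / 2 ^+ k = r / 2 ^+ (i + k).
  by rewrite /t exprD invfM mulrA.
have tk0 k : 0 < t / 2 ^+ k by rewrite divr_gt0// exprn_gt0.
have tkS k : 2 * (t / 2 ^+ k.+1) = t / 2 ^+ k.
  by rewrite exprS; field; rewrite expf_neq0.
have xy2 y : ball x t y -> ball y t `<=` ball x (2 * t).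
  by rewrite in_ball => xy; apply: subset_ball; lra.
have stop y : exists k, (S `&` ball x t) y ->
    tau < ball_mean mu g y (t / 2 ^+ k.+1) /\ ball_mean mu g y (t / 2 ^+ k) <= tau.
  have [[Sy xy]|] := pselect ((S `&` ball x t) y); last by exists 0%N.
  have [i0 hi0] := S_mean Sy (divr_gt0 tau0 (ltr0n R 2)).
  have exk : exists k, tau < ball_mean mu g y (t / 2 ^+ k).
    exists i0; have := hi0 _ (leq_addl i i0); rewrite -tk.
    have := ball_mean_dist m y (tk0 i0) lf; rewrite -/g.
    move: (ball_mean mu f y _) (ball_mean mu g y _) => a b ab a2.
    have : m - a <= b by apply: le_trans ab; rewrite distrC ler_norm.
    have : 2 * tau <= m by apply: le_trans hm; rewrite ler_peMl ?ler1n// mulr_ge0// ltW.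
    lra.
  have [[|k] hk kmin] := ex_minnP exk.
    (* The first scale is not the initial one: [ball y t] fills a fixed part of
       [ball x (2 * t)], where the mean of [g] is at most [(1 + cD) * eps]. *)
    exfalso; move: hk; apply/negP; rewrite -leNgt expr0 divr1.
    apply: (@le_trans _ _ (cD * ball_mean mu g x (2 * t))).
      apply: ball_mean_sub_ball => //; first exact: xy2.
      apply: mu_dbl => //; exists y; split; last by apply/in_ball; rewrite mdistxx.
      by apply: (ball_mono _ xy); rewrite ler_peMl ?ler1n// ltW.
    apply: (@le_trans _ _ (cD * ((1 + cD) * eps))); first by rewrite ler_pM2l.
    have -> : tau = (2 * cD) * (cD * ((1 + cD) * eps)) by rewrite /tau; ring.
    rewrite ler_peMl//; first by rewrite mulr_ge0// ltW.
    by move: cD1; lra.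
  exists k => _; split => //; rewrite leNgt; apply/negP => h.
  by have := kmin _ h; rewrite ltnn.
have [lev hlev] := choice stop.
have sub : S `&` ball x t `<=` ball x t by exact: subIsetr.
have mB2 := cara_measurable_ball x (2 * t).
pose c := 2 ^- n * (cD / tau).
have c0 : 0 <= c by rewrite mulr_ge0 ?invr_ge0 ?exprn_ge0// divr_ge0// ltW.
apply: (@le_trans _ _ (\int[cmu]_(y in ball x (2 * t)) (c * g y)%:E)%E).
  apply: (vitali_bound (lev := fun y => (lev y).+1) t0 t0 sub) => //.
  - by apply: measurable_funM => //; apply: measurable_funS lg.1.
  - by move=> y; rewrite mulr_ge0.
  - move=> y [_ xy]; apply: subset_trans (xy2 _ xy); apply: ball_mono.
    by rewrite ler_pdivrMr ?exprn_gt0// ler_peMr ?exprn_ege1 ?ler1n// ltW.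
  move=> y Ay; have [h1 h2] := hlev y Ay; rewrite tkS.
  apply: (@le_trans _ _ (mu (S `&` ball y (t / 2 ^+ lev y)))).
    by apply: le_outer_measure => z [[? ?] ?]; split.
  have hIH : n%:R * (2 * tau) <= ball_mean mu f y (t / 2 ^+ lev y).
    have := ball_mean_dist m y (tk0 (lev y)) lf; rewrite -/g.
    move: (ball_mean mu f y _) (ball_mean mu g y _) h2 => a b bt ab.
    have : m - a <= b by apply: le_trans ab; rewrite distrC ler_norm.
    move: hm; rewrite -natr1 mulrDl mul1r; lra.
  rewrite tk; apply: le_trans (IH _ _ _) _; first by rewrite -tk.
  rewrite -tk integral_ball_scaled//.
  apply: (@le_trans _ _ ((2 ^- n)%:E * (cD%:E * mu (ball y (t / 2 ^+ (lev y).+1))))%E).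
    apply: lee_wpmul2l; first by rewrite lee_fin invr_ge0 exprn_ge0.
    by rewrite -tkS; exact: mu_dbl_same.
  rewrite muleA -EFinM; apply: lee_wpmul2r; first exact: outer_measure_ge0.
  move: (ball_mean mu g y _) h1 => b h1.
  rewrite lee_fin /c -!mulrA ler_pM2l ?invr_gt0 ?exprn_gt0//.
  by rewrite ler_peMr ?(ltW cD0)// mulrC ler_pdivlMr// mul1r ltW.
rewrite integral_ball_scaled//.
apply: (@le_trans _ _ ((c * ((1 + cD) * eps))%:E * (cD%:E * mu (ball x t)))%E).
  apply: lee_pmul; rewrite ?outer_measure_ge0//.
  - by rewrite lee_fin mulr_ge0// ball_mean_ge0.
  - by rewrite lee_fin ler_wpM2l.
  - exact: mu_dbl_same.
rewrite muleA -EFinM; apply: lee_wpmul2r; first exact: outer_measure_ge0.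
rewrite lee_fin le_eqVlt; apply/orP; left; apply/eqP; rewrite /c /tau [2 ^+ n.+1]exprS.
have : 2 ^+ n != 0 :> R by rewrite expf_neq0.
move: (2 ^+ n) => u u0; field; rewrite u0 !gt_eqF//.
by rewrite addr_gt0.
Qed.

End john_nirenberg.

Lemma density_le_ball (S : set X) (x : X) (r a : R) : 0 < r ->
  (mu S / mu (ball x r) <= a%:E)%E = (mu S <= a%:E * mu (ball x r))%E.
Proof.
move=> r0; rewrite -(fineK (mu_ball_fin x r0)) inver gt_eqF ?mu_ball_gt0//.
by rewrite lee_pdivrMr// mu_ball_gt0.
Qed.

Lemma min_density_leP (N : nat) (E : 'I_N -> set X) (a : R) :
  min_density_le mu E a <-> forall x r, 0 < r ->
    exists j, (mu (E j `&` ball x r) <= a%:E * mu (ball x r))%E.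
Proof.
split=> h x r r0; last first.
  by have [j hj] := h x r r0; apply: (@bigmin_inf _ _ _ _ j) => //; rewrite density_le_ball.
apply: contrapT => /forallNP hN; have := h x r r0; apply/negP; rewrite -ltNge.
apply: lt_bigmin => [|j _]; first exact: ltry.
by rewrite ltNge density_le_ball//; apply/negP; exact: hN.
Qed.

Lemma loc_integrable_sum (I : eqType) (s : seq I) (f : I -> X -> R) :
  (forall j, loc_integrable mu (f j)) ->
  loc_integrable mu (fun y => \sum_(j <- s) f j y) /\
  forall x r, 0 < r -> ball_mean mu (fun y => \sum_(j <- s) f j y) x r =
    \sum_(j <- s) ball_mean mu (f j) x r.
Proof.
move=> lf; elim: s => [|j s [IH1 IH2]].
  rewrite (_ : (fun y => _) = cst 0); last by apply/funext => y; rewrite big_nil.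
  by split=> [|x r r0]; [exact: loc_integrable_cst|rewrite big_nil ball_mean_cst].
rewrite (_ : (fun y => _) = (fun y => f j y + \sum_(j <- s) f j y)); last first.
  by apply/funext => y; rewrite big_cons.
split=> [|x r r0]; last by rewrite big_cons ball_meanD// IH2.
exact: loc_integrableD (lf j) IH1.
Qed.

(** Such an [f] is at most the indicator of the complement of [E]. *)
Lemma ball_mean_vanishing (E : set X) (f : X -> R) (x : X) (r delta : R) : 0 < r ->
  measurable (E : set cT) -> loc_integrable mu f -> (forall y, 0 <= f y <= 1) ->
  {ae cmu, forall y, y \in E -> f y = 0} ->
  (mu (ball x r `\` E) <= delta%:E * mu (ball x r))%E ->
  ball_mean mu f x r <= delta.
Proof.
move=> r0 mE lf f01 f0 h.
rewrite -lee_fin -(@lee_pmul2r _ (mu (ball x r))) ?mu_ball_fin//; last first.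
  by have /andP[] := mu_pos x r0.
rewrite -integral_ballE//; apply: le_trans h.
have mEC : measurable (~` E : set cT) by exact: measurableC.
have mB := cara_measurable_ball x r.
have := @integral_indic _ _ _ cmu _ mB _ mEC; rewrite setIC -setDE => <-.
apply: ae_ge0_le_integral => //.
- by move=> y _; rewrite lee_fin; have /andP[] := f01 y.
- by apply/measurable_EFinP; apply: measurable_funS lf.1.
- by apply/measurable_EFinP; exact: measurable_indic.
have [Z [mZ Z0 hZ]] := f0; exists Z; split=> //; apply: subset_trans hZ.
apply: subsetC => y /= fy By; rewrite lee_fin indicE.
have [Ey|Ey] := pselect (E y).
  by rewrite fy ?inE.
by rewrite mem_set//; have /andP[] := f01 y.
Qed.

(** Discarding a null set, the points of [E] are density points, and there the
    means of [f] tend to 0. *)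
Lemma vanishing_set_decay (E : set X) (f : X -> R) (x : X) (r eps : R) (n : nat) :
  0 < r -> 0 < eps -> measurable (E : set cT) ->
  loc_integrable mu f -> (forall y, 0 <= f y <= 1) ->
  {ae cmu, forall y, y \in E -> f y = 0} -> (bmo_norm mu f <= eps%:E)%E ->
  n%:R * (jn_const * eps) <= ball_mean mu f x r ->
  (mu (E `&` ball x r) <= (2 ^- n)%:E * mu (ball x r))%E.
Proof.
move=> r0 eps0 mE lf f01 f0 /(bmo_norm_leP _ lf) fosc hn.
have [Z Z0 hZ] := almost_all_density_points mE r0.
have S_mean y : (E `\` Z) y -> forall delta : R, 0 < delta ->
    exists i0, forall i, (i0 <= i)%N -> ball_mean mu f y (r / 2 ^+ i) <= delta.
  move=> [Ey Zy] delta d0; have [i0 hi0] := hZ _ Ey Zy _ d0.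
  exists i0 => i /hi0; apply: ball_mean_vanishing => //.
  by rewrite divr_gt0// exprn_gt0.
have := @john_nirenberg f eps r (E `\` Z) lf eps0 r0 fosc S_mean n x 0%N.
rewrite expr0 divr1 => /(_ hn); apply: le_trans.
apply: (@le_trans _ _ (mu (((E `\` Z) `&` ball x r) `|` Z))).
  apply: le_outer_measure => y [Ey By].
  by have [Zy|Zy] := pselect (Z y); [right|left].
by apply: le_trans (outer_measureU2 mu _ _) _; rewrite Z0 adde0.
Qed.

(** Some [f j] has mean at least [1 / N] over the given ball. *)
Theorem partition_min_density (N : nat) (E : 'I_N -> set X) (f : 'I_N -> X -> R)
    (eps : R) (n : nat) :
  (0 < N)%N -> 0 < eps -> (forall j, measurable (E j : set cT)) ->
  bmo_partition mu E eps f -> N%:R * (n%:R * (jn_const * eps)) <= 1 ->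
  min_density_le mu E (2 ^- n).
Proof.
move=> N0 eps0 mE [fsum hf] hn; apply/min_density_leP => x r r0.
have lf j : loc_integrable mu (f j) by have [] := hf j.
have [_ /(_ x r r0)] := loc_integrable_sum (index_enum 'I_N) lf.
rewrite (_ : (fun y => _) = cst 1); last by apply/funext => y; exact: fsum.
rewrite ball_mean_cst// => sum1.
have [j hj] : exists j, n%:R * (jn_const * eps) <= ball_mean mu (f j) x r.
  apply: contrapT => /forallNP hN.
  have : \sum_(j < N) ball_mean mu (f j) x r < \sum_(j < N) n%:R * (jn_const * eps).
    apply: ltr_sum => [|j _]; last by rewrite ltNge; apply/negP; exact: hN.
    by apply/hasP; exists (Ordinal N0) => //; exact: mem_index_enum.
  by rewrite -sum1 sumr_const card_ord -[ltRHS]mulr_natl ltNge hn.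
exists j; have [f01 f0 _ fb] := hf j.
exact: vanishing_set_decay hj.
Qed.

End doubling_space.

(** * Upper limits of sequences in the unit interval *)
Section limsup.
Context {R : realType}.
Implicit Types u v : nat -> R.

Definition unit_seq u := forall n, 0 <= u n <= 1.

Lemma unit_seq_bounded u : unit_seq u -> bounded_fun u.
Proof.
move=> hu; exists 1; split => [|M M1 n _ /=]; first exact: num_real.
by have /andP[u0 u1] := hu n; rewrite ger0_norm// (le_trans u1)// ltW.
Qed.

Lemma limn_sup_le u v (delta : R) : unit_seq u -> unit_seq v ->
  (exists n0, forall n, (n0 <= n)%N -> u n <= v n + delta) ->
  limn_sup u <= limn_sup v + delta.
Proof.
move=> bu bv [n0 h].
have [bu' bv'] := (unit_seq_bounded bu, unit_seq_bounded bv).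
rewrite !limn_supE// -lerBlDr.
apply: lb_le_inf; first by exists (sups v 0%N), 0%N.
move=> _ [n _ <-]; rewrite lerBlDr.
pose m := maxn n n0.
apply: (@le_trans _ _ (sups u m)).
  by apply: ge_inf; [exact: bounded_fun_has_lbound_sups|exists m].
have ubv := bounded_fun_has_ubound bv'.
apply: (@le_trans _ _ (sups v m + delta)); last first.
  by rewrite lerD2r; apply: nonincreasing_sups => //; exact: leq_maxl.
apply: ge_sup; first by exists (u m), m => /=.
move=> _ [k /= mk <-]; apply: le_trans (h _ _) _.
  by apply: leq_trans mk; exact: leq_maxr.
rewrite lerD2r; apply: ub_le_sup; last by exists k.
by apply: has_ubound_sdrop.
Qed.

Lemma limn_sup_cst (c : R) : limn_sup (fun _ : nat => c) = c.
Proof. by have [_ ->] := @cvg_limn_inf_sup _ (fun _ => c) c (cvg_cst c). Qed.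

Lemma limn_sup_dist u (c delta : R) : unit_seq u -> 0 <= c <= 1 ->
  (exists n0, forall n, (n0 <= n)%N -> `|u n - c| <= delta) ->
  `|limn_sup u - c| <= delta.
Proof.
move=> bu c01 [n0 h]; have bc : unit_seq (fun=> c) by move=> n.
rewrite ler_distl lerBlDr; apply/andP; split.
  rewrite -{1}(limn_sup_cst c); apply: limn_sup_le => //; exists n0 => n /h.
  by rewrite ler_distl lerBlDr => /andP[].
rewrite -[X in _ <= X + _](limn_sup_cst c); apply: limn_sup_le => //; exists n0 => n /h.
by rewrite ler_distl => /andP[].
Qed.

End limsup.

(** * The play operator *)
Section play.
Context {R : realType}.
Implicit Types (a b : int -> R) (k : int).

(** The play operator follows a moving interval [a k, b k] with least motion:
    [play a b k] is the projection of [play a b (k - 1)] onto it ([play_step]).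
    Here it is started at [-oo], as the infimum over [s] of [play_from a b s k],
    which is [b (k - s)] pushed up by the lower obstacles met at the times
    [k - s + 1, ..., k].  The greatest solution is the one obtained; the
    infimum formula also makes it measurable in parameters. *)
Fixpoint play_from a b (s : nat) k : R :=
  if s is s'.+1 then Num.max (a k) (play_from a b s' (k - 1)) else b k.

Definition play a b k : R := infs (fun s => play_from a b s k) 0.

Definition obstacles a b := forall k, 0 <= a k /\ a k <= b k.

Lemma play_from_ge a b s k : obstacles a b -> a k <= play_from a b s k.
Proof. by move=> ab; case: s => [|s] /=; [have [] := ab k|rewrite le_max lexx]. Qed.

Lemma play_from_lb a b k : obstacles a b -> lbound (range (fun s => play_from a b s k)) (a k).
Proof. by move=> ab _ [s _ <-]; exact: play_from_ge. Qed.

Lemma playE a b k : play a b k = inf (range (fun s => play_from a b s k)).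
Proof.
rewrite /play /infs/=; congr inf; apply/seteqP; split => [_ [s _ <-]|_ [s _ <-]].
  by exists s.
by exists s.
Qed.

Lemma play_ge_lb a b c k : (forall s, c <= play_from a b s k) -> c <= play a b k.
Proof.
move=> h; rewrite playE; apply: lb_le_inf; first by exists (play_from a b 0 k), 0%N.
by move=> _ [s _ <-].
Qed.

Lemma play_le_from a b k s : obstacles a b -> play a b k <= play_from a b s k.
Proof.
move=> ab; rewrite playE; apply: ge_inf; last by exists s.
by exists (a k); exact: play_from_lb.
Qed.

Lemma play_ge a b k : obstacles a b -> a k <= play a b k.
Proof. by move=> ab; apply: play_ge_lb => s; exact: play_from_ge. Qed.

Lemma play_le a b k : obstacles a b -> play a b k <= b k.
Proof. exact: (@play_le_from _ _ _ 0). Qed.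

(** The step [s + 1] of the infimum at time [k] is the step [s] at time [k - 1],
    pushed up by [a k]. *)
Lemma play_step a b k : obstacles a b ->
  play a b k = Num.min (b k) (Num.max (a k) (play a b (k - 1))).
Proof.
move=> ab; apply/eqP; rewrite eq_le; apply/andP; split.
  rewrite le_min play_le//= leNgt; apply/negP => h.
  have [h1 h2] : a k < play a b k /\ play a b (k - 1) < play a b k.
    by move: h; rewrite gt_max => /andP[].
  have [_ [s _ <-] hs] : exists2 x, range (fun s => play_from a b s (k - 1)) x & x < play a b k.
    apply: inf_lt; last by rewrite -playE.
    by exists (play_from a b 0 (k - 1)), 0%N.
  have := play_le_from k s.+1 ab; rewrite /= leNgt => /negP; apply.
  by rewrite gt_max h1.
apply: play_ge_lb => -[|s] /=; first by rewrite ge_min lexx.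
by rewrite ge_min; apply/orP; right; rewrite ge_max !le_max lexx play_le_from// orbT.
Qed.

(** Nonexpansiveness for the sup norm over the past: each [play_from a b s k] is a
    maximum of values of the obstacles. *)
Lemma play_lip a b a' b' (delta : R) k : obstacles a b -> obstacles a' b' ->
  (forall i, (i <= k)%R -> a i <= a' i + delta /\ b i <= b' i + delta) ->
  play a b k <= play a' b' k + delta.
Proof.
move=> ab ab' h; rewrite -lerBlDr; apply: play_ge_lb => s; rewrite lerBlDr.
apply: le_trans (play_le_from k s ab) _.
elim: s k h => [|s IH] k h /=; first by have [] := h k (lexx _).
have k1 : k - 1 <= k by lia.
rewrite addr_maxl ge_max !le_max (h k (lexx _)).1/= IH ?orbT// => i ik.
by apply: h; apply: le_trans ik k1.
Qed.

(** The play moves up only when pushed by the lower obstacle and down only when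
    pushed by the upper one. *)
Lemma play_drift a b (delta : R) k0 : obstacles a b ->
  (forall n : nat, a (k0 + n%:Z) <= a k0 + delta /\ b k0 - delta <= b (k0 + n%:Z)) ->
  forall n : nat, play a b (k0 + n%:Z) <= play a b k0 + delta /\
    play a b k0 - delta <= play a b (k0 + n%:Z).
Proof.
move=> ab h n; have d0 : 0 <= delta by move: (h 0%N).1; rewrite addr0; lra.
elim: n => [|n [IH1 IH2]]; first by rewrite addr0; split; lra.
have E : k0 + n.+1%:Z - 1 = k0 + n%:Z by lia.
rewrite (play_step (k0 + n.+1%:Z) ab) E; have [h1 h2] := h n.+1.
have pa := play_ge k0 ab; have pb := play_le k0 ab; split.
  rewrite ge_min; apply/orP; right; rewrite ge_max IH1 andbT.
  by apply: le_trans h1 _; rewrite lerD2r.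
by rewrite le_min le_max IH2 orbT andbT; apply: le_trans h2; rewrite lerD2r.
Qed.

End play.

(** * Splitting a unit mass under moving capacities *)
Section cumulative.
Context {R : realType}.
Variable N : nat.
Implicit Type phi : nat -> int -> R.

(** The partial sum [G] up to [j] of a distribution with capacities [phi] must leave
    to the later indices no more than they can carry.  It is enough, and
    simpler, to ask that it leave at most what one of them can carry:
    [1 - tailmax phi j.+1 k <= G].  One capacity being 1, this can always be met. *)
Definition tailmax phi (j : nat) (k : int) : R :=
  \big[Num.max/0]_(j <= i < N) phi i k.

Definition lower phi (G : int -> R) j k := Num.max (G k) (1 - tailmax phi j.+1 k).
Definition upper phi (G : int -> R) j k := Num.min 1 (G k + phi j k).

(** The partial sums of the distribution, each lying between the previous one and
    the previous one plus a capacity. *)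
Fixpoint cumul phi (j : nat) : int -> R :=
  if j is j'.+1 then play (lower phi (cumul phi j') j') (upper phi (cumul phi j') j')
  else fun=> 0.

Lemma cumulS phi j : cumul phi j.+1 =
  play (lower phi (cumul phi j) j) (upper phi (cumul phi j) j).
Proof. by []. Qed.

Definition admissible phi := forall k, (forall i, 0 <= phi i k <= 1) /\
  exists2 i, (i < N)%N & phi i k = 1.

Lemma tailmax_recl phi j k : (j < N)%N ->
  tailmax phi j k = Num.max (phi j k) (tailmax phi j.+1 k).
Proof. by move=> jN; rewrite /tailmax big_ltn. Qed.

Lemma tailmaxN phi k : tailmax phi N k = 0.
Proof. by rewrite /tailmax big_geq. Qed.

Lemma tailmax_ge0 phi j k : 0 <= tailmax phi j k.
Proof. exact: bigmax_ge_id. Qed.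

Lemma tailmax_le1 phi j k : admissible phi -> tailmax phi j k <= 1.
Proof. by move=> /(_ k)[h _]; apply: bigmax_le => // i _; have /andP[] := h i. Qed.

Lemma tailmax0 phi k : admissible phi -> tailmax phi 0 k = 1.
Proof.
move=> ap; apply/eqP; rewrite eq_le tailmax_le1//=.
have [_ [i iN <-]] := ap k; apply: le_bigmax_seq => //.
by rewrite mem_index_iota.
Qed.

Lemma tailmax_le phi psi (delta : R) j k : 0 <= delta ->
  (forall i, phi i k <= psi i k + delta) ->
  tailmax phi j k <= tailmax psi j k + delta.
Proof.
move=> d0 h; rewrite /tailmax; elim/big_ind2 : _ => [|x1 x2 y1 y2 h1 h2|i _].
- by rewrite add0r.
- by rewrite ge_max addr_maxl !le_max h1 h2 orbT.
- exact: h.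
Qed.

(** The interval is nonempty: [tailmax phi j] is [phi j] or [tailmax phi j.+1], and
    in the former case [G + phi j] is at least 1. *)
Lemma obstacles_lower_upper phi (G : int -> R) j : admissible phi -> (j < N)%N ->
  (forall k, 0 <= G k <= 1 /\ 1 - tailmax phi j k <= G k) ->
  obstacles (lower phi G j) (upper phi G j).
Proof.
move=> ap jN hG k; have [/andP[G0 G1] GM] := hG k.
have [/(_ j)/andP[p0 p1] _] := ap k.
have t0 := tailmax_ge0 phi j.+1 k.
move: GM; rewrite tailmax_recl// /lower /upper le_max G0; split => //.
rewrite ge_max !le_min G1 lerDl p0 gerBl t0 /=.
by move: GM; rewrite maxEge; case: ifP => _; lra.
Qed.

Lemma cumul_bounds phi j : admissible phi -> (j <= N)%N -> forall k,
  0 <= cumul phi j k <= 1 /\ 1 - tailmax phi j k <= cumul phi j k.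
Proof.
move=> ap; elim: j => [|j IH] jN k; first by rewrite /= lexx ler01 tailmax0// subrr.
have obs := obstacles_lower_upper ap jN (IH (ltnW jN)).
have := play_ge k obs; have := play_le k obs; rewrite [cumul _ _ _]/=.
rewrite {1}/upper {1}/lower le_min ge_max => /andP[-> _] /andP[Gj ->].
have [/andP[G0 _] _] := IH (ltnW jN) k.
by rewrite andbT (le_trans G0).
Qed.

Lemma cumul_obstacles phi j : admissible phi -> (j < N)%N ->
  obstacles (lower phi (cumul phi j) j) (upper phi (cumul phi j) j).
Proof.
by move=> ap jN; apply: obstacles_lower_upper => //; apply: cumul_bounds => //; exact: ltnW.
Qed.

Lemma cumul_step phi j k : admissible phi -> (j < N)%N ->
  cumul phi j k <= cumul phi j.+1 k <= cumul phi j k + phi j k.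
Proof.
move=> ap jN; have obs := cumul_obstacles ap jN.
have := play_ge k obs; have := play_le k obs; rewrite [cumul _ j.+1 _]/=.
by rewrite {1}/upper {1}/lower le_min ge_max => /andP[_ ->] /andP[-> _].
Qed.

Lemma cumulN phi k : admissible phi -> cumul phi N k = 1.
Proof.
move=> ap; have [/andP[_ h1]] := cumul_bounds ap (leqnn N) k.
by rewrite tailmaxN subr0 => h2; apply/eqP; rewrite eq_le h1.
Qed.

(** Only the capacities at scales up to [k] count, with a loss of [delta] for each
    index. *)
Lemma cumul_lip phi psi (delta : R) j k : admissible phi -> admissible psi ->
  0 <= delta -> (j <= N)%N ->
  (forall i l, (l <= k)%R -> phi i l <= psi i l + delta /\ psi i l <= phi i l + delta) ->
  cumul phi j k <= cumul psi j k + j%:R * delta.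
Proof.
move=> ap aq d0; elim: j k => [|j IH] k jN h; first by rewrite /= mul0r addr0.
have jd : 0 <= j%:R * delta by rewrite mulr_ge0.
rewrite !cumulS; apply: play_lip; [exact: cumul_obstacles|exact: cumul_obstacles|move=> l lk].
have hG := IH l (ltnW jN) (fun i l' l'l => h i l' (le_trans l'l lk)).
have ht : tailmax psi j.+1 l <= tailmax phi j.+1 l + delta.
  by apply: tailmax_le => // i; exact: (h i l lk).2.
have hp := (h j l lk).1.
rewrite -natr1 mulrDl mul1r; split.
  rewrite /lower ge_max addr_maxl !le_max; apply/andP; split; apply/orP; [left|right]; lra.
rewrite /upper addr_minl le_min !ge_min; apply/andP; split; apply/orP; [left|right]; lra.
Qed.

(** Growing capacities push no partial sum, so that only decreases matter. *)
Lemma cumul_drift phi (delta : R) j k0 : admissible phi -> 0 <= delta -> (j <= N)%N ->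
  (forall i (n : nat), phi i k0 - delta <= phi i (k0 + n%:Z)) ->
  forall n : nat, cumul phi j (k0 + n%:Z) <= cumul phi j k0 + j%:R * delta /\
    cumul phi j k0 - j%:R * delta <= cumul phi j (k0 + n%:Z).
Proof.
move=> ap d0; elim: j => [|j IH] jN h; first by move=> n; rewrite /= mul0r addr0 subr0.
have jd : 0 <= j%:R * delta by rewrite mulr_ge0.
rewrite cumulS; apply: play_drift => [|n]; first exact: cumul_obstacles.
have [G1 G2] := IH (ltnW jN) h n.
have ht : tailmax phi j.+1 k0 <= tailmax phi j.+1 (k0 + n%:Z) + delta.
  apply: (@tailmax_le phi (fun i _ => phi i (k0 + n%:Z))) => // i.
  by rewrite -lerBlDr.
have hp := h j n.
rewrite -natr1 mulrDl mul1r; split.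
  rewrite /lower ge_max addr_maxl !le_max; apply/andP; split; apply/orP; [left|right]; lra.
rewrite lerBlDr /upper addr_minl le_min !ge_min; apply/andP; split; apply/orP; [left|right]; lra.
Qed.

Section measurability.
Context {d : measure_display} {T : measurableType d}.

Lemma measurable_play (a b : int -> T -> R) k :
  (forall l, measurable_fun setT (a l)) -> (forall l, measurable_fun setT (b l)) ->
  (forall x, obstacles (a ^~ x) (b ^~ x)) ->
  measurable_fun setT (fun x => play (a ^~ x) (b ^~ x) k).
Proof.
move=> ma mb ab; apply: measurable_fun_infs => [x _|s].
  by exists (a k x); exact: play_from_lb.
elim: s k => [|s IH] k /=; first exact: mb.
by apply: measurable_maxr => //; exact: IH.
Qed.

Lemma measurable_cumul (phi : nat -> int -> T -> R) j k :
  (forall i l, measurable_fun setT (phi i l)) ->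
  (forall x, admissible (fun i l => phi i l x)) -> (j <= N)%N ->
  measurable_fun setT (fun x => cumul (fun i l => phi i l x) j k).
Proof.
move=> mphi ap; elim: j k => [|j IH] k jN; first exact: measurable_cst.
have mt l : measurable_fun setT (fun x => tailmax (fun i l => phi i l x) j.+1 l).
  rewrite /tailmax; elim: (index_iota _ _) => [|i s IHs].
    by under eq_fun do rewrite big_nil; exact: measurable_cst.
  under eq_fun do rewrite big_cons.
  by apply: measurable_maxr; [exact: mphi|exact: IHs].
apply: (measurable_play (a := fun l x => lower (fun i l => phi i l x) (cumul (fun i l => phi i l x) j) j l)
  (b := fun l x => upper (fun i l => phi i l x) (cumul (fun i l => phi i l x) j) j l)).
- by move=> l; apply: measurable_maxr; [exact/IH/ltnW|exact: measurable_funB].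
- by move=> l; apply: measurable_minr => //; apply: measurable_funD => //; exact/IH/ltnW.
- by move=> x; exact: cumul_obstacles.
Qed.

End measurability.

End cumulative.

(** * Densities at dyadic scales *)
Section construction.
Context {R : realType} {X : completeMetricType R}.
Variable mu : {outer_measure set X -> \bar R}.
Variable cD : R.
Hypotheses (mu_reg : borel_regular mu) (mu_pos : positive_finite_on_balls mu).
Hypotheses (mu_dbl : doubling mu cD) (cD1 : 1 < cD).

Local Notation cmu := (cara_measure mu).
Local Notation cT := (caratheodory_type mu).

Let cD0 : 0 < cD. Proof. exact: lt_trans cD1. Qed.

Definition vol (S : set X) : R := fine (mu S).

Lemma vol_ge0 S : 0 <= vol S. Proof. exact/fine_ge0/outer_measure_ge0. Qed.

Lemma vol_ball_gt0 x t : 0 < t -> 0 < vol (ball x t).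
Proof. exact: mu_ball_gt0. Qed.

Lemma vol_le (S S' : set X) x t : 0 < t -> S' `<=` ball x t -> S `<=` S' -> vol S <= vol S'.
Proof.
move=> t0 S'B SS'; apply: fine_le; last exact: le_outer_measure.
- exact: (mu_sub_ball_fin mu_pos t0 (subset_trans SS' S'B)).
- exact: (mu_sub_ball_fin mu_pos t0 S'B).
Qed.

(** Balls being open, [vol (S `&` ball x t)] is already exceeded by slightly smaller
    balls, which the balls of radius [t] about nearby points contain. *)
Lemma open_superlevel_vol (S : set X) (t c : R) : 0 < t -> measurable (S : set cT) ->
  open [set x : X | c < vol (S `&` ball x t)].
Proof.
move=> t0 mS; rewrite openE => x /= cx.
pose F n := S `&` ball x (t - n.+1%:R^-1).
have mF n : measurable (F n : set cT).
  exact: (measurableI _ _ mS (cara_measurable_ball mu_reg x _)).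
have FE : \bigcup_n F n = S `&` ball x t.
  apply/seteqP; split => [y [n _ [Sy By]]|y [Sy]].
    by split => //; apply: ball_mono By; rewrite gerBl invr_ge0.
  rewrite in_ball -subr_gt0 => /ltr_add_invr[n hn]; exists n => //; split => //.
  by apply/in_ball; rewrite ltrBrDr addrC -ltrBrDr -[X in X < _]add0r.
have ndF : nondecreasing_seq F.
  apply/nondecreasing_seqP => n; apply/subsetPset; apply: setIS; apply: ball_mono.
  by rewrite lerD2l lerN2 lef_pV2 ?posrE// ler_nat.
have mFoo : measurable (\bigcup_n F n : set cT) by exact: bigcup_measurable.
have cv := @nondecreasing_cvg_mu _ _ _ cmu F mF mFoo ndF.
have oN : open_nbhs (mu (\bigcup_n F n)) [set y : \bar R | (c%:E < y)%E].
  split; first exact: open_ereal_gt_ereal.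
  rewrite /= FE -(fineK (mu_sub_ball_fin mu_pos t0 (@subIsetr _ S (ball x t)))) lte_fin.
  exact: cx.
have [n _ hn] := cv _ (open_nbhs_nbhs oN).
have {}hn : (c%:E < mu (F n))%E by exact: (hn n (leqnn n)).
apply/nbhs_ballP; exists n.+1%:R^-1 => /=; first by rewrite invr_gt0.
move=> y; rewrite in_ball => xy /=.
have FS : F n `<=` S `&` ball y t.
  apply: setIS; apply: subset_ball; rewrite metric_sym.
  by move: xy; move: (n.+1%:R^-1) => e; lra.
have := lt_le_trans hn (le_outer_measure mu _ _ FS).
by rewrite -(fineK (mu_sub_ball_fin mu_pos t0 (@subIsetr _ S (ball y t)))) lte_fin.
Qed.

Lemma measurable_vol (S : set X) (t : R) : 0 < t -> measurable (S : set cT) ->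
  measurable_fun [set: cT] (fun x : X => vol (S `&` ball x t)).
Proof.
move=> t0 mS; apply: (measurability _ (RGenOInfty.measurableE R)) => //.
move=> /= _ [_ [c ->] <-]; rewrite setTI; apply: (open_cara mu_reg).
rewrite (_ : _ @^-1` _ = [set x : X | c < vol (S `&` ball x t)]).
  exact: open_superlevel_vol.
by apply/seteqP; split => x /=; rewrite in_itv/= andbT.
Qed.

Definition rad (k : int) : R := 2 ^ (- k).

Lemma rad_gt0 k : 0 < rad k. Proof. exact: exprz_gt0. Qed.

Lemma rad_addn k (n : nat) : rad (k + n%:Z) = rad k / 2 ^+ n.
Proof. by rewrite /rad opprD expfzDr ?pnatr_eq0// exprnN. Qed.

Lemma rad_subn k (n : nat) : rad (k - n%:Z) = 2 ^+ n * rad k.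
Proof. by rewrite /rad opprB expfzDr ?pnatr_eq0// exprnP. Qed.

Lemma rad_pred k : rad (k - 1) = 2 * rad k.
Proof. by rewrite (rad_subn k 1) expr1. Qed.

Lemma rad_subn_ge k (n : nat) : rad k <= rad (k - n%:Z).
Proof. by rewrite rad_subn ler_peMl ?exprn_ege1 ?ler1n// ltW// rad_gt0. Qed.

Lemma rad_between (r : R) : 0 < r -> exists k, r <= rad k /\ rad k <= 2 * r.
Proof.
move=> r0; have r1 : 0 < r^-1 by rewrite invr_gt0.
pose P (n : nat) := r <= rad (n%:Z - (Num.bound r)%:Z).
have P0 : P 0%N.
  rewrite /P rad_subn /rad oppr0 expr0z mulr1 ltW//.
  exact: (@upper_nthrootP _ r).
have [n nP] : exists n, ~~ P n.
  exists (Num.bound r + Num.bound r^-1)%N; rewrite /P -ltNge.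
  rewrite (_ : _ - _ = (Num.bound r^-1)%:Z); last by lia.
  rewrite /rad -exprnN invf_plt ?posrE ?exprn_gt0//.
  exact: (@upper_nthrootP _ r^-1).
have exn : exists n, ~~ P n by exists n.
have [[|m] mP mmin] := ex_minnP exn; first by rewrite P0 in mP.
have Pm : P m by apply/negPn/negP => h; have := mmin _ h; rewrite ltnn.
exists (m%:Z - (Num.bound r)%:Z); split => //.
move: mP; rewrite /P -ltNge (_ : _ - _ = m%:Z - (Num.bound r)%:Z + 1%:Z); last by lia.
rewrite rad_addn expr1; lra.
Qed.

Definition dens (E : set X) (x : X) (k : int) : R :=
  vol (E `&` ball x (rad k)) / vol (ball x (rad k)).

Lemma dens_ge0 E x k : 0 <= dens E x k.
Proof. by rewrite divr_ge0 ?vol_ge0. Qed.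

Lemma dens_le1 E x k : dens E x k <= 1.
Proof.
rewrite ler_pdivrMr ?vol_ball_gt0 ?rad_gt0// mul1r.
apply: (vol_le (rad_gt0 k) (@subset_refl _ _)); exact: subIsetr.
Qed.

Lemma dens_parent E x y k : mdist x y < rad k ->
  dens E y k <= cD * dens E x (k - 1).
Proof.
move=> xy; have r0 := rad_gt0 k; have r10 := rad_gt0 (k - 1).
have vy := vol_ball_gt0 y r0; have vx := vol_ball_gt0 x r10.
have sub : ball y (rad k) `<=` ball x (rad (k - 1)).
  by rewrite rad_pred; apply: subset_ball; lra.
have dbl : vol (ball x (rad (k - 1))) <= cD * vol (ball y (rad k)).
  rewrite rad_pred -lee_fin EFinM !fineK ?mu_ball_fin ?mulr_gt0//.
  apply: mu_dbl => //; exists y; split; last by apply/in_ball; rewrite mdistxx.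
  by apply/in_ball; lra.
have num : vol (E `&` ball y (rad k)) <= vol (E `&` ball x (rad (k - 1))).
  apply: (vol_le r10 (@subIsetr _ E _)); exact: setIS.
rewrite /dens ler_pdivrMr//; apply: le_trans num _.
rewrite (_ : cD * _ * _ = vol (E `&` ball x (rad (k - 1))) *
  (cD * vol (ball y (rad k)) / vol (ball x (rad (k - 1))))); last by ring.
by rewrite ler_peMr ?vol_ge0// ler_pdivlMr// mul1r.
Qed.

(** The density itself is not comparable at nearby points, since [ball y (rad k)] is
    only contained in [ball x (rad (k - 1))].  Taking all coarser scales into account,
    discounted by [cD] per scale, absorbs this shift and gives [mdens_near]. *)
Definition mdens (E : set X) (x : X) (k : int) : R :=
  sups (fun i : nat => cD ^- i * dens E x (k - i%:Z)) 0.

Lemma mdensE E x k :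
  mdens E x k = sup (range (fun i : nat => cD ^- i * dens E x (k - i%:Z))).
Proof.
rewrite /mdens /sups/=; congr sup; apply/seteqP.
by split => _ [i _ <-]; exists i.
Qed.

Lemma dens_scaled_le1 E x k (i : nat) : cD ^- i * dens E x (k - i%:Z) <= 1.
Proof.
rewrite mulr_ile1 ?dens_ge0 ?dens_le1//; first by rewrite invr_ge0 exprn_ge0// ltW.
by rewrite invf_le1 ?exprn_gt0// exprn_ege1// ltW.
Qed.

Lemma mdens_ge E x k (i : nat) : cD ^- i * dens E x (k - i%:Z) <= mdens E x k.
Proof.
rewrite mdensE; apply: ub_le_sup; last by exists i.
by exists 1 => _ [j _ <-]; exact: dens_scaled_le1.
Qed.

Lemma mdens_le E x k (c : R) :
  (forall i : nat, cD ^- i * dens E x (k - i%:Z) <= c) -> mdens E x k <= c.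
Proof.
move=> h; rewrite mdensE; apply: ge_sup; last by move=> _ [i _ <-].
by exists (cD ^- 0 * dens E x (k - 0%:Z)), 0%N.
Qed.

Lemma mdens_gt E x k (c : R) : c < mdens E x k ->
  exists i : nat, c < cD ^- i * dens E x (k - i%:Z).
Proof.
move=> h; apply: contrapT => /forallNP hN; move: h; apply/negP; rewrite -leNgt.
by apply: mdens_le => i; rewrite leNgt; apply/negP; exact: hN.
Qed.

Lemma dens_le_mdens E x k : dens E x k <= mdens E x k.
Proof. by have := mdens_ge E x k 0; rewrite expr0 invr1 mul1r subr0. Qed.

Lemma mdens_near E x y k : mdist x y < rad k -> mdens E y k <= cD ^+ 2 * mdens E x k.
Proof.
move=> xy; apply: mdens_le => i.
have h : dens E y (k - i%:Z) <= cD * dens E x (k - i.+1%:Z).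
  have -> : k - i.+1%:Z = k - i%:Z - 1 by lia.
  by apply: dens_parent; apply: lt_le_trans xy _; exact: rad_subn_ge.
have := mdens_ge E x k i.+1; rewrite -(ler_pM2l (exprn_gt0 2 cD0)).
apply: le_trans.
apply: (@le_trans _ _ (cD ^- i * (cD * dens E x (k - i.+1%:Z)))).
  by rewrite ler_wpM2l// invr_ge0 exprn_ge0// ltW.
have cn0 : cD != 0 by rewrite gt_eqF.
rewrite le_eqVlt; apply/orP; left; apply/eqP.
by rewrite [cD ^+ i.+1]exprS; field; rewrite cn0 expf_neq0.
Qed.

Lemma dens_iter E x k (i : nat) : dens E x k <= cD ^+ i * dens E x (k - i%:Z).
Proof.
elim: i k => [|i IH] k; first by rewrite expr0 mul1r subr0.
apply: le_trans (IH k) _; rewrite exprSr -mulrA ler_pM2l ?exprn_gt0//.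
rewrite (_ : k - i.+1%:Z = k - i%:Z - 1); last by lia.
by apply: dens_parent; rewrite mdistxx rad_gt0.
Qed.

Lemma measurable_dens E k : measurable (E : set cT) ->
  measurable_fun [set: cT] (fun x : X => dens E x k).
Proof.
move=> mE; apply: measurable_funM; first exact: measurable_vol (rad_gt0 k) mE.
have h : measurable_fun [set: cT] (fun x : X => vol (ball x (rad k))).
  have := measurable_vol (rad_gt0 k) (@measurableT _ cT).
  by under eq_fun do rewrite setTI.
apply: (eq_measurable_fun (fun x : cT => vol (ball x (rad k)) `^ (-1))) => [x _|].
  by rewrite powR_inv1// vol_ge0.
exact: measurableT_comp (measurable_powR _) h.
Qed.

Lemma measurable_mdens E k : measurable (E : set cT) ->
  measurable_fun [set: cT] (fun x : X => mdens E x k).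
Proof.
move=> mE; apply: measurable_fun_sups => [x _|i].
  by exists 1 => _ [i _ <-]; exact: dens_scaled_le1.
by apply: measurable_funM => //; exact: measurable_dens.
Qed.

(** * Logarithmic levels *)
Section level.
Variable lambda : R.
Hypothesis lam1 : 1 < lambda.

Let lam0 : 0 < lambda. Proof. exact: lt_trans lam1. Qed.
Let lncD0 : 0 < ln cD. Proof. exact: ln_gt0. Qed.

(** Minus the logarithm in base [cD], in units of [lambda]: a factor [cD ^+ m] in
    the density is a change of [m / lambda]. *)
Definition logl (t : R) : R := - (ln t / (lambda * ln cD)).

Lemma logl_le (s t : R) (m : nat) : 0 < s -> 0 < t -> s <= cD ^+ m * t ->
  logl t <= logl s + m%:R / lambda.
Proof.
move=> s0 t0 st.
have : ln s <= ln cD *+ m + ln t.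
  rewrite -lnXn// -lnM ?posrE ?exprn_gt0// ler_ln ?posrE//.
  by rewrite mulr_gt0 ?exprn_gt0.
rewrite -mulr_natr => h; rewrite /logl -subr_ge0.
rewrite (_ : _ - _ = (ln cD * m%:R + ln t - ln s) / (lambda * ln cD)).
  by apply: divr_ge0; [lra|rewrite mulr_ge0// ltW].
by field; rewrite !gt_eqF.
Qed.

Lemma logl_powR (a : R) : logl (cD `^ (- a)) = a / lambda.
Proof. by rewrite /logl ln_powR; field; rewrite !gt_eqF. Qed.

(** The truncation keeps [level] at most 1 and the logarithm away from 0. *)
Definition qdens (E : set X) (x : X) (k : int) : R :=
  Num.max (mdens E x k) (cD `^ (- lambda)).

Lemma floor_gt0 : 0 < cD `^ (- lambda). Proof. exact: powR_gt0. Qed.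

Lemma qdens_gt0 E x k : 0 < qdens E x k.
Proof. by rewrite /qdens lt_max floor_gt0 orbT. Qed.

Lemma qdens_ge E x k : mdens E x k <= qdens E x k.
Proof. by rewrite /qdens le_max lexx. Qed.

Lemma mdens_le1 E x k : mdens E x k <= 1.
Proof. by apply: mdens_le => i; exact: dens_scaled_le1. Qed.

Definition level (E : set X) (k : int) (x : X) : R := logl (qdens E x k).

Lemma level01 E k x : 0 <= level E k x <= 1.
Proof.
apply/andP; split.
  have : qdens E x k <= 1.
    rewrite ge_max mdens_le1 /= -[leRHS](powRr0 cD).
    by apply: ler_powR; [exact: ltW|rewrite oppr_le0 ltW].
  rewrite -[X in _ <= X](mul1r 1) -(expr0 cD) => /(logl_le (qdens_gt0 E x k) ltr01).
  by rewrite /logl ln1 mul0r oppr0 mul0r addr0.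
have : cD `^ (- lambda) <= cD ^+ 0 * qdens E x k.
  by rewrite expr0 mul1r le_max lexx orbT.
move/(logl_le floor_gt0 (qdens_gt0 E x k)).
by rewrite logl_powR mul0r addr0 divff// gt_eqF.
Qed.

Lemma qdens_near E x y k : mdist x y < rad k ->
  qdens E y k <= cD ^+ 2 * qdens E x k.
Proof.
move=> xy; have c1 : 1 <= cD ^+ 2 by rewrite exprn_ege1// ltW.
rewrite {1}/qdens ge_max; apply/andP; split.
  apply: le_trans (mdens_near E xy) _.
  by rewrite ler_pM2l ?exprn_gt0// qdens_ge.
apply: (@le_trans _ _ (qdens E x k)); first by rewrite le_max lexx orbT.
by rewrite ler_peMl// ltW// qdens_gt0.
Qed.

Lemma level_near E x y k : mdist x y < rad k ->
  level E k x <= level E k y + 2 / lambda.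
Proof.
by move=> xy; apply: logl_le; rewrite ?qdens_gt0 ?qdens_near.
Qed.

Lemma level_eq1 E x k : mdens E x k <= cD `^ (- lambda) -> level E k x = 1.
Proof.
move=> h; rewrite /level /qdens (max_idPr h) logl_powR divff// gt_eqF//.
Qed.

Lemma level_small E x k (eta : R) : cD `^ (- (lambda * eta)) <= dens E x k ->
  level E k x <= eta.
Proof.
move=> h; have h' : cD `^ (- (lambda * eta)) <= cD ^+ 0 * qdens E x k.
  rewrite expr0 mul1r; apply: le_trans h _.
  by apply: le_trans (dens_le_mdens _ _ _) (qdens_ge _ _ _).
have := logl_le (powR_gt0 _ cD0) (qdens_gt0 E x k) h'.
by rewrite logl_powR mul0r addr0 mulrC mulKf// gt_eqF.
Qed.

(** About [lambda] scales coarser than [k0] the density is at most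
    [cD `^ (- (4 * lambda))].  From there down to [k0] it gains at most a factor [cD] per
    scale, so it stays below [cD `^ (- lambda)]; still coarser scales are discounted
    below that by the definition of [mdens]. *)
Lemma level_full (E : set X) x k0 :
  dens E x (k0 - (Num.truncn lambda).+1%:Z) <= cD `^ (- (4 * lambda)) ->
  level E k0 x = 1.
Proof.
set m := (Num.truncn lambda).+1 => h; apply: level_eq1; apply: mdens_le => i.
have lm : lambda < m%:R by exact: truncnS_gt.
have ml : m%:R <= lambda + 1.
  by rewrite /m -natr1 lerD2r truncn_le// ltW.
clearbody m.
have [im|mi] := leqP i m.
  apply: (@le_trans _ _ (cD ^+ m * dens E x (k0 - m%:Z))).
    have := dens_iter E x (k0 - i%:Z) (m - i).
    rewrite (_ : k0 - i%:Z - (m - i)%N%:Z = k0 - m%:Z); last by lia.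
    move=> hi; apply: (@le_trans _ _ (dens E x (k0 - i%:Z))).
      rewrite ler_piMl ?dens_ge0// invf_le1 ?exprn_gt0// exprn_ege1// ltW//.
    apply: le_trans hi _; rewrite ler_wpM2r ?dens_ge0// ler_weXn2l ?ltW//.
    exact: leq_subr.
  apply: (@le_trans _ _ (cD ^+ m * cD `^ (- (4 * lambda)))).
    by rewrite ler_pM2l// exprn_gt0.
  rewrite -powR_mulrn; last exact: ltW.
  rewrite -powRD; last by rewrite (gt_eqF cD0) implybT.
  apply: ler_powR; [exact: ltW|].
  by move: ml lam1; move: (m%:R) => u; lra.
apply: (@le_trans _ _ (cD ^- i)).
  by rewrite ler_piMr ?dens_le1// invr_ge0 exprn_ge0// ltW.
rewrite -powR_invn; last exact: ltW.
apply: ler_powR; first exact: ltW.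
rewrite lerN2; apply: le_trans (ltW lm) _; by rewrite ler_nat ltnW.
Qed.

(** The discounted density at scale [k0 + n] owes its size to a scale finer than
    [k0], because the contribution of the coarser ones is already part of
    [mdens E x k0]. *)
Lemma level_drop E x k0 (n m : nat) :
  level E (k0 + n%:Z) x < level E k0 x - m%:R / lambda ->
  exists l : nat, cD ^+ m * qdens E x k0 < dens E x (k0 + l%:Z).
Proof.
move=> h.
have hq : cD ^+ m * qdens E x k0 < qdens E x (k0 + n%:Z).
  rewrite ltNge; apply/negP => h'; move: h; apply/negP; rewrite -leNgt lerBlDr.
  exact: logl_le (qdens_gt0 _ _ _) (qdens_gt0 _ _ _) h'.
have c1 : 1 <= cD ^+ m by rewrite exprn_ege1// ltW.
have q0 := qdens_gt0 E x k0.
have qm : qdens E x k0 <= cD ^+ m * qdens E x k0 by rewrite ler_peMl// ltW.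
move: hq; rewrite {2}/qdens lt_max => /orP[|]; last first.
  move=> h'; exfalso; move: h'; apply/negP; rewrite -leNgt; apply: le_trans qm.
  by rewrite le_max lexx orbT.
move=> /mdens_gt[i hi].
have [il|li] := leqP i n.
  exists (n - i)%N; apply: lt_le_trans hi _.
  rewrite (_ : k0 + n%:Z - i%:Z = k0 + (n - i)%N%:Z); last by lia.
  by rewrite ler_piMl ?dens_ge0// invf_le1 ?exprn_gt0// exprn_ege1// ltW.
exfalso; move: hi; apply/negP; rewrite -leNgt; apply: le_trans qm.
apply: le_trans (qdens_ge _ _ _); apply: le_trans (mdens_ge E x k0 (i - n)).
rewrite (_ : k0 + n%:Z - i%:Z = k0 - (i - n)%N%:Z); last by lia.
rewrite ler_wpM2r ?dens_ge0// lef_pV2 ?posrE ?exprn_gt0//.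
by rewrite ler_weXn2l ?ltW// leq_subr.
Qed.

Lemma measurable_level E k : measurable (E : set cT) ->
  measurable_fun [set: cT] (level E k).
Proof.
move=> mE.
have mq : measurable_fun [set: cT] (fun x : X => qdens E x k).
  by apply: measurable_maxr => //; exact: measurable_mdens.
apply: (eq_measurable_fun (fun x : cT => - (lambda * ln cD)^-1 * ln (qdens E x k))) => [x _|].
  by rewrite /level /logl mulNr mulrC.
by apply: measurable_funM => //; exact: measurableT_comp (@measurable_ln R) mq.
Qed.

Definition drop_set (E : set X) (k0 : int) (m : nat) : set X :=
  [set x | exists n : nat, level E (k0 + n%:Z) x < level E k0 x - m%:R / lambda].

(** The weak type inequality: at a point of the set, some small ball has density at
    least [cD ^+ m] times [qdens E x k0], which is comparable to [qdens E z k0],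
    and the latter dominates, up to a factor [cD], the density of [E] in a ball containing all these small
    balls. *)
Lemma drop_set_small E z r k0 m : measurable (E : set cT) -> 0 < r ->
  r <= rad k0 -> rad k0 <= 2 * r ->
  (mu (drop_set E k0 m `&` ball z r) <= (cD ^+ 6 / cD ^+ m)%:E * mu (ball z r))%E.
Proof.
move=> mE r0 rk kr; set A := _ `&` _.
pose t := rad k0; have t0 : 0 < t := rad_gt0 k0.
have hlev x : exists l, A x -> cD ^+ m * qdens E x k0 < dens E x (k0 + l%:Z).
  have [[[n /level_drop[l hl]] _]|] := pselect (A x); last by exists 0%N.
  by exists l.
have [lev hl] := choice hlev.
have Az : A `<=` ball z r by exact: subIsetr.
pose U := ball z (rad (k0 - 1)).
have mU : measurable (U : set cT) by exact: (cara_measurable_ball mu_reg).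
pose c := cD ^+ 3 / (cD ^+ m * qdens E z k0).
have q0 := qdens_gt0 E z k0.
have cm0 : 0 < cD ^+ m by rewrite exprn_gt0.
have c0 : 0 <= c by rewrite divr_ge0 ?exprn_ge0// ?mulr_ge0// ltW.
apply: (@le_trans _ _ (\int[cmu]_(y in U) (c * \1_(E : set cT) y)%:E)%E).
  apply: (vitali_bound (lev := lev) mu_reg mu_pos mu_dbl cD1 t0 r0 Az) => //.
  - by apply: measurable_funM => //; exact: measurable_indic.
  - by move=> x; rewrite mulr_ge0.
  - move=> x [_ zx]; apply: subset_trans (ball_mono (x := x) (s := t) _) _.
      by rewrite ler_pdivrMr ?exprn_gt0// ler_peMr ?exprn_ege1 ?ler1n// ltW.
    by rewrite /U rad_pred; apply: subset_ball; move: zx; rewrite in_ball /t; lra.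
  move=> x Ax; have := hl x Ax; have [_ zx] := Ax.
  rewrite integral_scaled_indic//; last exact: (cara_measurable_ball mu_reg).
  rewrite /dens rad_addn -/t; set B := ball x (t / 2 ^+ lev x) => hd.
  have tk0 : 0 < t / 2 ^+ lev x by rewrite divr_gt0// exprn_gt0.
  have vB : 0 < vol B := vol_ball_gt0 x tk0.
  have qz : qdens E z k0 <= cD ^+ 2 * qdens E x k0.
    apply: qdens_near; move: zx; rewrite in_ball metric_sym => /lt_le_trans.
    by apply.
  apply: (@le_trans _ _ (mu (ball x (2 * (t / 2 ^+ lev x))))).
    by apply: le_outer_measure; exact: subIsetr.
  apply: le_trans (mu_dbl_same mu_dbl x tk0) _.
  rewrite -(fineK (mu_ball_fin mu_pos x tk0)).
  rewrite -(fineK (mu_sub_ball_fin mu_pos tk0 (@subIsetr _ E B))) -!EFinM lee_fin.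
  rewrite -/(vol B) -/(vol (E `&` B)).
  have h1 : vol B * (cD ^+ m * qdens E x k0) <= vol (E `&` B).
    by move: hd; rewrite ltr_pdivlMr// mulrC => /ltW.
  rewrite /c mulrAC ler_pdivlMr ?mulr_gt0//.
  apply: (@le_trans _ _ (cD * vol B * (cD ^+ m * (cD ^+ 2 * qdens E x k0)))).
    by rewrite ler_pM2l ?mulr_gt0// ler_pM2l.
  rewrite (_ : _ * _ = cD ^+ 3 * (vol B * (cD ^+ m * qdens E x k0))); last by ring.
  by rewrite ler_pM2l// exprn_gt0.
rewrite integral_scaled_indic//.
have rU := rad_gt0 (k0 - 1).
have hU : (mu U <= (cD ^+ 2)%:E * mu (ball z r))%E.
  apply: le_trans (mu_dbl_iter mu_dbl cD1 2 z r0).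
  by apply: le_outer_measure; apply: ball_mono; rewrite rad_pred expr2; lra.
have hEU : vol (E `&` U) <= cD * qdens E z k0 * vol U.
  have : cD ^- 1 * dens E z (k0 - 1%:Z) <= qdens E z k0.
    exact: le_trans (mdens_ge E z k0 1) (qdens_ge _ _ _).
  rewrite expr1 ler_pdivrMl// ler_pdivrMr//; exact: vol_ball_gt0.
move: hU; rewrite -(fineK (mu_ball_fin mu_pos z r0)) -(fineK (mu_ball_fin mu_pos z rU)).
rewrite -(fineK (mu_sub_ball_fin mu_pos rU (@subIsetr _ E U))) -!EFinM !lee_fin.
rewrite -/(vol _) -/(vol (ball z r)) -/(vol (E `&` U)) => hU.
apply: (@le_trans _ _ (c * (cD * qdens E z k0 * (cD ^+ 2 * vol (ball z r))))).
  rewrite ler_wpM2l//; apply: le_trans hEU _; rewrite ler_pM2l//; exact: mulr_gt0.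
rewrite le_eqVlt; apply/orP; left; apply/eqP; rewrite /c.
by field; rewrite !gt_eqF.
Qed.

End level.


(** * From distribution to mean oscillation *)
Lemma staircase (w t : R) (M : nat) : 0 < w -> t <= w * M%:R ->
  t <= \sum_(m < M) w * (w * m%:R < t)%R%:R.
Proof.
move=> w0; elim: M => [|M IH] h; first by rewrite big_ord0 (le_trans h)// mulr0.
rewrite big_ord_recr /=; have [tM|Mt] := leP t (w * M%:R).
  by rewrite mulr0 addr0 IH.
apply: le_trans h _.
have -> : \sum_(i < M) w * (w * i%:R < t)%R%:R = \sum_(i < M) w.
  apply: eq_bigr => i _; rewrite (_ : w * i%:R < t) ?mulr1//.
  by apply: le_lt_trans Mt; rewrite ler_pM2l// ler_nat ltnW.
by rewrite sumr_const card_ord mulr1 -natr1 mulrDr mulr1 lerD2r mulr_natr.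
Qed.

Lemma geometric_sum_le (M : nat) : \sum_(m < M) cD ^- m <= cD / (cD - 1).
Proof.
have c1 : 0 < cD - 1 by rewrite subr_gt0.
suff -> : \sum_(m < M) cD ^- m = (1 - cD ^- M) * (cD / (cD - 1)).
  apply: ler_piMl; first by rewrite divr_ge0// ltW.
  by rewrite gerBl invr_ge0 exprn_ge0// ltW.
elim: M => [|M IH]; first by rewrite big_ord0 expr0 invr1 subrr mul0r.
rewrite big_ord_recr/= IH exprS.
have : cD ^+ M != 0 by rewrite expf_neq0// gt_eqF.
by move: (cD ^+ M) => u u0; field; rewrite u0 (gt_eqF cD0) (gt_eqF c1).
Qed.

(** A discrete layer-cake formula: a function at most [w * M%:R] is at most [w] times
    the number of the levels [w * m%:R], [m < M], that it exceeds. *)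
Lemma ball_mean_decay (h : X -> R) (w K Mb : R) x r : 0 < r -> 0 < w -> 0 <= K ->
  measurable_fun [set: cT] h -> (forall y, 0 <= h y <= Mb) ->
  (forall m : nat, (mu ([set y | (w * m%:R < h y)%R] `&` ball x r) <=
     (K / cD ^+ m)%:E * mu (ball x r))%E) ->
  ball_mean mu h x r <= w * K * (cD / (cD - 1)).
Proof.
move=> r0 w0 K0 mh h0 hK.
pose M := (Num.truncn (Mb / w)).+1.
pose S (m : nat) := [set y : X | w * m%:R < h y].
have mS m : measurable (S m : set cT).
  rewrite (_ : S m = h @^-1` `](w * m%:R), +oo[).
    by rewrite -[X in measurable X]setTI; apply: mh.
  by apply/seteqP; split => y /=; rewrite in_itv/= andbT.
pose s (m : 'I_M) (y : X) : R := w * \1_(S m : set cT) y.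
have ls (m : 'I_M) : loc_integrable mu (s m).
  apply: (loc_integrable_bounded mu_reg mu_pos (M := w)).
    by apply: measurable_funM => //; exact: measurable_indic.
  move=> y; rewrite /s indicE ger0_norm; last by rewrite mulr_ge0// ltW.
  by case: (_ \in _); rewrite ?mulr1// mulr0 ltW.
have lh : loc_integrable mu h.
  apply: (loc_integrable_bounded mu_reg mu_pos (M := Mb)) => // y.
  by have /andP[y0 yM] := h0 y; rewrite ger0_norm.
have [lsum msum] := loc_integrable_sum mu_reg mu_pos (index_enum 'I_M) ls.
apply: (@le_trans _ _ (ball_mean mu (fun y => \sum_(m < M) s m y) x r)).
  apply: (ball_mean_le mu_reg) => // y _.
  have hM : h y <= w * M%:R.
    have /andP[_ yM] := h0 y; apply: le_trans yM _.
    by rewrite mulrC -ler_pdivrMr// ltW// truncnS_gt.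
  apply: le_trans (staircase w0 hM) _; apply: ler_sum => m _.
  rewrite /s indicE ler_pM2l// (_ : y \in _ = (w * m%:R < h y))//.
  by apply/idP/idP; rewrite in_setE.
rewrite msum//.
apply: (@le_trans _ _ (\sum_(m < M) w * K * cD ^- m)); last first.
  rewrite -mulr_sumr ler_wpM2l ?geometric_sum_le//.
  by rewrite mulr_ge0// ltW.
apply: ler_sum => m _.
have mB := cara_measurable_ball mu_reg x r.
rewrite -lee_fin -(@lee_pmul2r _ (mu (ball x r))) ?(mu_ball_fin mu_pos)//; last first.
  by have /andP[] := mu_pos x r0.
rewrite -(integral_ballE mu_reg)// (integral_scaled_indic (mS m) mB) ?(ltW w0)//.
rewrite -mulrA EFinM -muleA; apply: lee_wpmul2l; first by rewrite lee_fin ltW.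
exact: hK.
Qed.

(** * The partition *)
Section partition.
Variables (lambda : R) (N : nat) (E : 'I_N -> set X).
Hypotheses (lam1 : 1 < lambda) (N0 : (0 < N)%N).
Hypothesis mE : forall j, measurable (E j : set cT).
Hypothesis hE : min_density_le mu E (cD `^ (- (4 * lambda))).

Let lam0 : 0 < lambda. Proof. exact: lt_trans lam1. Qed.

(* The capacities are indexed by all natural numbers; indices from [N] on repeat
   the set of index 0, so that every index stands for one of the sets. *)
Let set_at (i : nat) : set X := E (insubd (Ordinal N0) i).

Let set_at_ord (j : 'I_N) : set_at j = E j.
Proof. by rewrite /set_at valKd. Qed.

Let phi (i : nat) (k : int) (x : X) : R := level lambda (set_at i) k x.

Let phi_adm x : admissible N (fun i k => phi i k x).
Proof.
move=> k; split=> [i|]; first exact: level01.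
have [j hj] := (min_density_leP mu_pos E _).1 hE x _ (rad_gt0 (k - (Num.truncn lambda).+1%:Z)).
exists j => //; rewrite /phi set_at_ord; apply: level_full => //.
have r0 := rad_gt0 (k - (Num.truncn lambda).+1%:Z).
rewrite /dens ler_pdivrMr; last exact: vol_ball_gt0.
rewrite -lee_fin EFinM !fineK//; first exact: (mu_ball_fin mu_pos).
exact: (mu_sub_ball_fin mu_pos r0 (@subIsetr _ _ _)).
Qed.

Let G (j : nat) (k : int) (x : X) : R := cumul N (fun i l => phi i l x) j k.

(* An upper limit of the partial sums exists everywhere, is monotone in [j] and is
   measurable; the differences sum to 1 by telescoping. *)
Let g (j : nat) (x : X) : R := limn_sup (fun n : nat => G j n%:Z x).

Let part (j : 'I_N) (x : X) : R := g j.+1 x - g j x.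

Let G_unit j x : (j <= N)%N -> unit_seq (fun n : nat => G j n%:Z x).
Proof. by move=> jN n; have [] := cumul_bounds (phi_adm x) jN n%:Z. Qed.

Let g01 j x : (j <= N)%N -> 0 <= g j x <= 1.
Proof.
move=> jN; have u := G_unit x jN.
have u0 : unit_seq (fun _ : nat => 0 : R) by move=> n; rewrite lexx ler01.
have u1 : unit_seq (fun _ : nat => 1 : R) by move=> n; rewrite lexx ler01.
apply/andP; split.
  have := @limn_sup_le _ _ _ 0 u0 u; rewrite limn_sup_cst addr0; apply.
  by exists 0%N => n _; rewrite addr0; have /andP[] := u n.
have := @limn_sup_le _ _ _ 0 u u1; rewrite limn_sup_cst addr0; apply.
by exists 0%N => n _; have /andP[] := u n.
Qed.

Let g_mono j x : (j < N)%N -> g j x <= g j.+1 x.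
Proof.
move=> jN; have := @limn_sup_le _ _ _ 0 (G_unit x (ltnW jN)) (G_unit x jN).
rewrite addr0; apply; exists 0%N => n _; rewrite addr0.
by have /andP[] := cumul_step n%:Z (phi_adm x) jN.
Qed.

Let part01 j x : 0 <= part j x <= 1.
Proof.
have jN := ltn_ord j.
have := g_mono x jN; have /andP[g0 _] := g01 x (ltnW jN).
by have /andP[_ g1] := g01 x jN; rewrite /part; lra.
Qed.

Let part_sum x : \sum_(j < N) part j x = 1.
Proof.
rewrite -(big_mkord xpredT (fun j => g j.+1 x - g j x)) telescope_sumr//.
have -> : g 0 x = 0 by exact: limn_sup_cst.
rewrite subr0 /g (_ : (fun n => _) = fun=> 1) ?limn_sup_cst//.
by apply/funext => n; exact: cumulN.
Qed.

Let measurable_g j : (j <= N)%N -> measurable_fun [set: cT] (g j).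
Proof.
move=> jN; apply: measurable_fun_limn_sup => [x _|x _|n].
- exact/bounded_fun_has_ubound/unit_seq_bounded/G_unit.
- exact/bounded_fun_has_lbound/unit_seq_bounded/G_unit.
by apply: measurable_cumul => // i l; apply: measurable_level => //; exact: mE.
Qed.

Let measurable_part j : measurable_fun [set: cT] (part j).
Proof. by apply: measurable_funB; apply: measurable_g; [|exact: ltnW]. Qed.

Let part_loc j : loc_integrable mu (part j).
Proof.
apply: (loc_integrable_bounded mu_reg mu_pos (M := 1)) => // x.
by have /andP[p0 p1] := part01 j x; rewrite ger0_norm.
Qed.

(* At a density point of [E j] the capacity [phi j k] tends to 0, hence the partial
   sums of index [j] and [j.+1] have the same upper limit. *)
Let part_vanishes j : {ae cmu, forall x, x \in E j -> part j x = 0}.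
Proof.
have [Z Z0 hZ] := almost_all_density_points mu_reg mu_pos mu_dbl cD1 (mE j) ltr01.
have mZ : measurable (Z : set cT) := null_measurable Z0.
exists Z; split => // x /= hx; apply: contrapT => Zx; apply: hx => /set_mem Ex.
have jN := ltn_ord j; apply/eqP; rewrite /part subr_eq0 eq_le g_mono// andbT.
apply/ler_addgt0Pr => eta eta0.
apply: limn_sup_le; [exact: G_unit|exact/G_unit/ltnW|].
pose a := cD `^ (- (lambda * eta)).
have a1 : a < 1.
  by rewrite /a /powR gt_eqF// -[ltRHS]expR0 ltr_expR mulNr oppr_lt0 mulr_gt0// ?mulr_gt0// ln_gt0.
have d0 : 0 < 1 - a by rewrite subr_gt0.
have [n0 hn0] := hZ x Ex Zx _ d0; exists n0 => n n0n.
have /andP[_ h] := cumul_step n%:Z (phi_adm x) jN; apply: le_trans h _; rewrite lerD2l.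
rewrite /phi set_at_ord; apply: level_small => //; rewrite -/a.
have := hn0 n n0n.
have r0 := rad_gt0 n%:Z; rewrite (_ : 1 / 2 ^+ n = rad n%:Z); last first.
  by rewrite -[n%:Z]add0r rad_addn.
set B := ball x _ => hB.
have hU : (mu B <= mu (E j `&` B) + mu (B `\` E j))%E.
  apply: le_trans (outer_measureU2 mu _ _); apply: le_outer_measure => y By.
  by have [?|?] := pselect (E j y); [left|right].
have fB : mu B \is a fin_num := mu_ball_fin mu_pos x r0.
have fE : mu (E j `&` B) \is a fin_num := mu_sub_ball_fin mu_pos r0 (@subIsetr _ _ _).
rewrite /dens -/B ler_pdivlMr; last exact: vol_ball_gt0.
move: hB hU; have fD : mu (B `\` E j) \is a fin_num.
  exact: (mu_sub_ball_fin mu_pos r0 (@subDsetl _ _ _)).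
rewrite -(fineK fB) -(fineK fE) -(fineK fD) -EFinM -EFinD !lee_fin.
rewrite -/(vol B) -/(vol (E j `&` B)); lra.
Qed.

Definition bmo_const : R := 4 * N%:R ^+ 2 * cD ^+ 9 / (cD - 1).

(* Comparing the value at [x] with the distribution at [z] and scale [k0]: moving
   from [z] to [x] at scale [k0] costs [2 / lambda] and refining the scale at [x]
   costs [m / lambda], at most [N] times for each of the two partial sums. *)
Let part_near (j : 'I_N) z r k0 (m : nat) x : r <= rad k0 ->
  ball z r x -> (forall i : 'I_N, ~ drop_set lambda (E i) k0 m x) ->
  `|part j x - (G j.+1 k0 z - G j k0 z)| <= 2 * N%:R / lambda * (m + 2)%:R.
Proof.
move=> rk zx hx.
have xz : mdist x z < rad k0.
  by move: zx; rewrite in_ball metric_sym => /lt_le_trans; apply.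
have ml0 : 0 <= m%:R / lambda by rewrite divr_ge0// ltW.
have l20 : 0 <= 2 / lambda by rewrite divr_ge0// ltW.
have key i : (i <= N)%N -> `|g i x - G i k0 z| <= N%:R * (m%:R / lambda + 2 / lambda).
  move=> iN; apply: limn_sup_dist.
  - exact: G_unit.
  - by have [] := cumul_bounds (phi_adm z) iN k0.
  exists `|k0|%N => n kn.
  have -> : n%:Z = k0 + `|n%:Z - k0|%N%:Z by lia.
  move: (`|n%:Z - k0|%N) => n'.
  have drift i' n'' : phi i' k0 x - m%:R / lambda <= phi i' (k0 + n''%:Z) x.
    rewrite leNgt; apply/negP => h; apply: (hx (insubd (Ordinal N0) i')).
    by exists n''.
  have [h1 h2] := cumul_drift (phi_adm x) ml0 iN drift n'.
  have near i' l : (l <= k0)%R -> phi i' l x <= phi i' l z + 2 / lambda /\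
      phi i' l z <= phi i' l x + 2 / lambda.
    move=> lk; have xl : mdist x z < rad l.
      apply: lt_le_trans xz _; rewrite (_ : l = k0 - `|k0 - l|%N%:Z); last by lia.
      exact: rad_subn_ge.
    by split; apply: level_near => //; rewrite metric_sym.
  have h3 := cumul_lip (phi_adm x) (phi_adm z) l20 iN near.
  have h4 := cumul_lip (phi_adm z) (phi_adm x) l20 iN (fun i' l lk => conj (near i' l lk).2 (near i' l lk).1).
  have iN1 : i%:R * (m%:R / lambda) <= N%:R * (m%:R / lambda).
    by rewrite ler_wpM2r// ler_nat.
  have iN2 : i%:R * (2 / lambda) <= N%:R * (2 / lambda).
    by rewrite ler_wpM2r// ler_nat.
  rewrite ler_distl mulrDr /G; apply/andP; split; lra.
have := key _ (ltn_ord j); have := key _ (ltnW (ltn_ord j)).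
have -> : 2 * N%:R / lambda * (m + 2)%:R = N%:R * (m%:R / lambda + 2 / lambda) +
   N%:R * (m%:R / lambda + 2 / lambda) by rewrite natrD; field; rewrite gt_eqF.
rewrite /part !ler_distl; move: (N%:R * _) => b; move: (g _ x) (g _ x) (G _ _ _) (G _ _ _).
by move=> a1 a2 a3 a4; lra.
Qed.

(* Outside the sets of drop [m - 2] the function differs from [c] by at most
   [w * m%:R]; for [m < 2] the trivial bound suffices. *)
Let part_bmo j : (bmo_norm mu (part j) <= (bmo_const / lambda)%:E)%E.
Proof.
apply/(bmo_norm_leP mu_reg mu_pos _ (part_loc j)) => z r r0.
have [k0 [rk kr]] := rad_between r0.
pose c := G j.+1 k0 z - G j k0 z.
apply: le_trans (osc_le mu_reg mu_pos c z r0 (part_loc j)) _.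
pose w := 2 * N%:R / lambda; pose K := N%:R * cD ^+ 8.
have N1 : 1 <= N%:R :> R by rewrite ler1n.
have N00 : 0 < N%:R :> R by rewrite ltr0n.
have w0 : 0 < w by rewrite divr_gt0// mulr_gt0.
have K0 : 0 <= K by rewrite mulr_ge0// exprn_ge0// ltW.
have c01 : 0 <= c <= 1.
  have /andP[s1 s2] := cumul_step k0 (phi_adm z) (ltn_ord j).
  have [/andP[g0 _] _] := cumul_bounds (phi_adm z) (ltnW (ltn_ord j)) k0.
  have [/andP[_ g1] _] := cumul_bounds (phi_adm z) (ltn_ord j) k0.
  by rewrite /c /G; lra.
have -> : bmo_const / lambda = 2 * (w * K * (cD / (cD - 1))).
  by rewrite /bmo_const /w /K; field; rewrite !gt_eqF// subr_gt0.
rewrite ler_pM2l//; apply: (@ball_mean_decay _ w K 1) => //.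
- apply: measurableT_comp => //; exact: measurable_funB.
- move=> y; rewrite normr_ge0 ler_norml; have := part01 j y; lra.
move=> m; set S := [set y | _].
have B0 : (0 <= mu (ball z r))%E by exact: outer_measure_ge0.
have cm0 (i : nat) : 0 < cD ^+ i by rewrite exprn_gt0.
have [m2|m2] := ltnP m 2.
  apply: (@le_trans _ _ (1%:E * mu (ball z r))%E).
    by rewrite mul1e; apply: le_outer_measure; exact: subIsetr.
  apply: lee_wpmul2r => //; rewrite lee_fin ler_pdivlMr// mul1r /K.
  apply: (@le_trans _ _ (cD ^+ 8)); last by rewrite ler_peMl// ltW.
  by apply: ler_weXn2l; [exact: ltW|exact: leq_trans (ltnW m2) _].
have -> : K / cD ^+ m = \sum_(i < N) (cD ^+ 6 / cD ^+ (m - 2)).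
  rewrite sumr_const card_ord /K -[in LHS](subnK m2) exprD -mulr_natl.
  have : cD ^+ (m - 2) != 0 by rewrite gt_eqF.
  by move: (cD ^+ (m - 2)) => u u0; field; rewrite u0 gt_eqF.
pose F (i : 'I_N) := drop_set lambda (E i) k0 (m - 2) `&` ball z r.
have sub : S `&` ball z r `<=` \big[setU/set0]_(i <- index_enum 'I_N) F i.
  move=> y [Sy zy]; apply: contrapT => h.
  have : `|part j y - c| <= w * (m - 2 + 2)%:R.
    apply: (@part_near j z r k0 (m - 2)%N y rk zy) => i hi; apply: h; rewrite -bigcup_seq.
    by exists i => //=; exact: mem_index_enum.
  by rewrite subnK// leNgt => /negP; apply.
apply: le_trans (le_outer_measure mu _ _ sub) _.
apply: le_trans (outer_measure_bigsetU_le _ _ _) _.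
rewrite -sumEFin ge0_sume_distrl; last first.
  by move=> i _; rewrite lee_fin divr_ge0// ltW.
by apply: lee_sum => i _; exact: drop_set_small.
Qed.

Theorem bmo_partition_exists : exists f : 'I_N -> X -> R,
  bmo_partition mu E (bmo_const / lambda) f.
Proof.
exists part; split; first exact: part_sum.
by move=> j; split=> // x; exact: part01.
Qed.

End partition.

End construction.

(** * Densities and partitions of small mean oscillation *)

Theorem theorem2p1 (R : realType) (cD : R) (N : nat)
    (hcD : 1 < cD) (hN : (2 <= N)%N) :
  exists c1 c2 : R, 0 < c1 /\ 0 < c2 /\
    forall (X : completeMetricType R) (mu : {outer_measure set X -> \bar R}),
      borel_regular mu -> positive_finite_on_balls mu -> doubling mu cD ->
      forall (lambda : R) (E : 'I_N -> set X),
        1 < lambda -> (forall j : 'I_N, mu.-caratheodory (E j)) ->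
        (min_density_le mu E (cD `^ (- (4 * lambda))) ->
           exists f : 'I_N -> X -> R, bmo_partition mu E (c1 / lambda) f)
        /\
        ((exists f : 'I_N -> X -> R, bmo_partition mu E (c2 / lambda) f) ->
           min_density_le mu E (cD `^ (- (4 * lambda)))).
Proof.
have cD0 : 0 < cD by exact: lt_trans hcD.
have N0 : (0 < N)%N by exact: ltnW.
have N0' : 0 < N%:R :> R by rewrite ltr0n.
(* Any [m] with [cD ^+ 4 <= 2 ^+ m] turns a decay [2 ^- n] with [m%:R * lambda <= n%:R]
   into the required density; [m.+1] in the constant below pays for rounding. *)
pose m := Num.bound (cD ^+ 4).
have hm : cD ^+ 4 <= 2 ^+ m by rewrite ltW// (@upper_nthrootP _ (cD ^+ 4)).
have j0 : 0 < jn_const cD by rewrite /jn_const !mulr_gt0 ?exprn_gt0// addr_gt0.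
have m1 : 0 < m.+1%:R :> R by rewrite ltr0n.
exists (bmo_const cD N), (N%:R * jn_const cD * m.+1%:R)^-1; split; [|split].
- rewrite /bmo_const divr_gt0 ?subr_gt0// !mulr_gt0// ?exprn_gt0//.
- by rewrite invr_gt0; exact: mulr_gt0 (mulr_gt0 N0' j0) m1.
move=> X mu mu_reg mu_pos mu_dbl lambda E lam1 mE; split=> [hE|[f hf]].
  exact: bmo_partition_exists hE.
have lam0 : 0 < lambda by exact: lt_trans lam1.
pose n := Num.truncn (m.+1%:R * lambda).
have ml0 : 0 <= m.+1%:R * lambda by rewrite mulr_ge0// ltW.
have nle : n%:R <= m.+1%:R * lambda by rewrite truncn_le.
have nge : m%:R * lambda <= n%:R.
  have : m.+1%:R * lambda < n.+1%:R by exact: truncnS_gt.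
  by rewrite -!natr1 mulrDl mul1r; move: (m%:R * lambda) (n%:R) lam1 => a b; lra.
have eps0 : 0 < (N%:R * jn_const cD * m.+1%:R)^-1 / lambda.
  by apply: divr_gt0 => //; rewrite invr_gt0; exact: mulr_gt0 (mulr_gt0 N0' j0) m1.
have hn : N%:R * (n%:R * (jn_const cD *
    ((N%:R * jn_const cD * m.+1%:R)^-1 / lambda))) <= 1.
  rewrite [leLHS](_ : _ = n%:R / (m.+1%:R * lambda)).
    by rewrite ler_pdivrMr ?mul1r// mulr_gt0.
  by field; rewrite !gt_eqF.
have := partition_min_density mu_reg mu_pos mu_dbl hcD N0 eps0 mE hf hn.
move=> h x r r0; apply: le_trans (h x r r0) _; rewrite lee_fin powRN.
rewrite lef_pV2 ?posrE ?powR_gt0 ?exprn_gt0//.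
rewrite powRrM (_ : cD `^ 4 = cD ^+ 4); last first.
  by rewrite -powR_mulrn// ltW.
apply: (@le_trans _ _ ((2 ^+ m) `^ lambda)).
  by apply: ge0_ler_powR; rewrite ?nnegrE ?exprn_ge0// ltW.
rewrite -!powR_mulrn// -powRrM; apply: ler_powR => //.
by rewrite ler1n.
Qed.
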